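(* If $f$ is a Rogers function and $\zeta\in\mathbf{C}_\to$, then $$g(\xi)=\frac{\xi^2}{(\xi-\zeta)(\xi+\bar\zeta)}\left(f(\xi)-\operatorname{Re}f(\zeta)-\frac{i\xi+\operatorname{Im}\zeta}{\operatorname{Re}\zeta}\,\operatorname{Im}f(\zeta)\right),$$ defined for $\xi\in\mathbf{C}_\to\setminus\{\zeta\}$ and extended continuously at $\xi=\zeta$, is a Rogers function. In particular, if $f$ is a nonconstant Rogers function, $\zeta\in\mathbf{C}_\to$ and $f(\zeta)\in(0,\infty)$, then $$f_{[\zeta]}(\xi)=\frac{(\xi-\zeta)(\xi+\bar\zeta)}{f(\xi)-f(\zeta)},\qquad\xi\in\mathbf{C}_\to\setminus\{\zeta\},$$ extended continuously at $\xi=\zeta$ so that $f_{[\zeta]}(\zeta)=(2\operatorname{Re}\zeta)/f'(\zeta)$, defines a Rogers function.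
   Context: $\mathbf{C}_\to=\{\xi\in\mathbf{C}:\operatorname{Re}\xi>0\}$. A Rogers function is a holomorphic function $f$ on $\mathbf{C}_\to$ with $\operatorname{Re}(f(\xi)/\xi)\ge0$ for all $\xi\in\mathbf{C}_\to$. *)

(* Defs.v *)
From Stdlib Require Import Reals.
From Coquelicot Require Import Coquelicot.
Open Scope C_scope.

Definition right_half_plane (xi : C) : Prop := (0 < Re xi)%R.

(** Functions on the open half-plane are total functions [C -> C] of which only
    the values on the half-plane matter.  The half-plane being open, complex
    differentiability at its points does not depend on the values outside. *)
Definition holomorphic_rhp (f : C -> C) : Prop :=
  forall xi : C, right_half_plane xi ->
    ex_derive (K := C_AbsRing) (V := C_NormedModule) f xi.

Definition Rogers (f : C -> C) : Prop :=
  holomorphic_rhp f /\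
  forall xi : C, right_half_plane xi -> (0 <= Re (f xi / xi))%R.

Definition nonconstant_rhp (f : C -> C) : Prop :=
  ~ (exists c : C, forall xi : C, right_half_plane xi -> f xi = c).

(** [G] extends [g], whose domain is the half-plane minus [zeta], continuously
    to [zeta].  The value of the formula [g] at [zeta] is never used; [G] is
    unique on the half-plane. *)
Definition continuous_extension (g : C -> C) (zeta : C) (G : C -> C) : Prop :=
  (forall xi : C, right_half_plane xi -> xi <> zeta -> G xi = g xi) /\
  continuous (T := C_UniformSpace) (U := C_UniformSpace) G zeta.

Definition rogers_g (f : C -> C) (zeta xi : C) : C :=
  xi ^ 2 / ((xi - zeta) * (xi + Cconj zeta)) *
  (f xi - Re (f zeta) - (Ci * xi + Im zeta) / Re zeta * Im (f zeta)).

Definition rogers_bracket (f : C -> C) (zeta xi : C) : C :=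
  (xi - zeta) * (xi + Cconj zeta) / (f xi - f zeta).

(* Main.v *)
Require Import Defs.
From Stdlib Require Import Reals.
From Coquelicot Require Import Coquelicot.
From Stdlib Require Import Lra Classical ClassicalEpsilon FunctionalExtensionality PropExtensionality.
Open Scope C_scope.
Set Bullet Behavior "Strict Subproofs".

(** Put [h = f / xi].  At two points [xi, zeta] the Schwarz-Pick inequality says
    that the matrix with entries [(h a + conj (h b)) / (a + conj b)] is positive
    semidefinite, and [Re (g xi / xi)] is a positive multiple of the value of
    this quadratic form at the vector [(xi, - zeta)].  This gives the first half
    away from [zeta]; at [zeta] it follows by continuity, [g] being holomorphic
    there because a difference quotient of a holomorphic function is.

    If [f zeta] is real, then [f_[zeta] xi = xi ^ 2 / g xi], so only zeros of [g]
    have to be excluded.  A zero of [g / xi], again by Schwarz-Pick, forces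
    [g = 0], that is, [f] constant.

    Schwarz-Pick itself comes from the maximum modulus principle on the
    Apollonius circles around [zeta].  As holomorphic means complex
    differentiable, the Cauchy theory starts from Goursat's lemma.  For Cauchy's
    formula the difference quotient [q] at an interior point [z] needs a primitive
    on the punctured domain: near a point [x], Goursat provides one on the part
    of the domain in the half-plane through [z] facing [x], and it differs by a
    constant from the integral of [q] over the segment from [z]. *)

(** * Complex derivatives *)

(** The term subtracted from [f] in [g] is the one function [A + B * i * xi] with real [A], [B] that
    agrees with [f] at [zeta]. So the numerator vanishes there and [xi - zeta] can be divided out. A
    zero is divided out a second time in Schwarz-Pick, where [(h - h zeta) / (h + conj (h zeta))] is
    divided by [(xi - zeta) / (xi + conj zeta)]. The obstacle is that such a quotient must again be
    differentiable at the zero. Its continuity there is immediate, but Goursat's lemma cannot be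
    applied across a point of mere continuity. Cauchy's formula is therefore proved with a quotient
    known only to be continuous at one point; the formula then gives a Taylor expansion of second
    order, and this makes the quotient differentiable. Schwarz-Pick is finally brought into a
    determinant form without division, which remains valid where [Re h = 0]. The exclusion of zeros
    rests on this degenerate case: a vanishing real part at one point annihilates the right-hand
    side for all other points. *)

Definition cderiv (f : C -> C) (x l : C) : Prop :=
  is_derive (K := C_AbsRing) (V := C_NormedModule) f x l.

(** [C] has two normed-module structures over itself, and the product and chain rules speak of the
    second. Norm and scalar action coincide, so the remainder condition passes over by
    conversion. *)
Lemma is_derive_C_AbsRing (f : C -> C) (x l : C) :
  is_derive (K := C_AbsRing) (V := AbsRing_NormedModule C_AbsRing) f x l <-> cderiv f x l.
Proof.
split; intros [_ H]; (split; [apply @is_linear_scal_l| exact H]).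
Qed.

Lemma cderiv_mult (f g : C -> C) (x df dg : C) :
  cderiv f x df -> cderiv g x dg -> cderiv (fun y => f y * g y) x (df * g x + f x * dg).
Proof. rewrite <- !is_derive_C_AbsRing. intros H1 H2. exact (is_derive_mult (K:=C_AbsRing) f g x df dg H1 H2 Cmult_comm). Qed.

Lemma cderiv_plus (f g : C -> C) (x df dg : C) :
  cderiv f x df -> cderiv g x dg -> cderiv (fun y => f y + g y) x (df + dg).
Proof. exact (is_derive_plus f g x df dg). Qed.

Lemma cderiv_id x : cderiv (fun y => y) x 1.
Proof. apply is_derive_C_AbsRing; exact (is_derive_id (K:=C_AbsRing) x). Qed.

Lemma cderiv_const (c x : C) : cderiv (fun _ => c) x 0.
Proof. exact (is_derive_const (K:=C_AbsRing) (V:=C_NormedModule) c x). Qed.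

Lemma cderiv_iff (f : C -> C) (x l : C) :
  cderiv f x l <->
  forall eps : R, (0 < eps)%R -> exists delta : R, (0 < delta)%R /\
    forall y, (Cmod (y - x) < delta)%R -> (Cmod (f y - f x - (y - x) * l) <= eps * Cmod (y - x))%R.
Proof.
split.
- intros [_ H] eps He.
  destruct (H x (fun P H => H) (mkposreal eps He)) as [d Hd].
  exists d; split; [apply cond_pos|]. intros y Hy. exact (Hd y Hy).
- intros H. split.
  + apply @is_linear_scal_l.
  + intros y Hy eps.
    assert (E : x = y) by (apply (is_filter_lim_locally_unique (K:=C_AbsRing) (V:=AbsRing_NormedModule C_AbsRing)); exact Hy).
    subst y.
    destruct (H eps (cond_pos eps)) as [d [Hd0 Hd]].
    exists (mkposreal d Hd0). intros y Hy'. exact (Hd y Hy').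
Qed.

(** The balls of [C_UniformSpace] are products of coordinate intervals; [locally_C] exchanges them
    for discs in [Cmod]. *)
Lemma continuous_C_iff (f : C -> C) (x : C) :
  continuous (T := C_UniformSpace) (U := C_UniformSpace) f x <->
  forall eps : R, (0 < eps)%R -> exists delta : R, (0 < delta)%R /\
    forall y, (Cmod (y - x) < delta)%R -> (Cmod (f y - f x) < eps)%R.
Proof.
split.
- intros H eps He.
  destruct (H (fun w => (Cmod (w - f x) < eps)%R)) as [d Hd].
  { apply (locally_C (f x)). exists (mkposreal eps He). intros w Hw; exact Hw. }
  exists d; split; [apply cond_pos|]. intros y Hy. apply Hd.
  apply C_NormedModule_mixin_compat1. exact Hy.
- intros H P HP.
  apply locally_C in HP. destruct HP as [e He].
  destruct (H e (cond_pos e)) as [d [Hd0 Hd]].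
  apply locally_C. exists (mkposreal d Hd0). intros y Hy. apply He. exact (Hd y Hy).
Qed.

Definition rderiv (g : R -> C) (t : R) (l : C) : Prop :=
  is_derive (K := R_AbsRing) (V := C_R_NormedModule) g t l.

Lemma norm_C_R (z : C) : norm (V := C_R_NormedModule) z = Cmod z.
Proof. symmetry; apply Cmod_norm. Qed.

Lemma rderiv_iff (g : R -> C) (t : R) (l : C) :
  rderiv g t l <->
  forall eps : R, (0 < eps)%R -> exists delta : R, (0 < delta)%R /\
    forall s, (Rabs (s - t) < delta)%R ->
      (Cmod (g s - g t - RtoC (s - t) * l) <= eps * Rabs (s - t))%R.
Proof.
split.
- intros [_ H] eps He.
  destruct (H t (fun P H => H) (mkposreal eps He)) as [d Hd].
  exists d; split; [apply cond_pos|]. intros y Hy.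
  rewrite <- (scal_R_Cmult (y - t) l). rewrite Cmod_norm. exact (Hd y Hy).
- intros H. split.
  + apply @is_linear_scal_l.
  + intros y Hy eps.
    assert (E : t = y) by (apply (is_filter_lim_locally_unique (K:=R_AbsRing) (V:=R_NormedModule)); exact Hy).
    subst y.
    destruct (H eps (cond_pos eps)) as [d [Hd0 Hd]].
    exists (mkposreal d Hd0). intros y Hy'. specialize (Hd y Hy').
    rewrite <- (scal_R_Cmult (y - t) l) in Hd. rewrite Cmod_norm in Hd. exact Hd.
Qed.

(** The two derivatives have different scalar fields, so the remainder is estimated directly: it is
    the remainder of [F] at the increment of [g], plus [l] times the remainder of [g]. Each gets
    half of [eps]; [M] bounds the increment of [g] relative to [s - t]. *)
Lemma cderiv_comp_curve (F : C -> C) (g : R -> C) (t : R) (l dg : C) :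
  cderiv F (g t) l -> rderiv g t dg -> rderiv (fun s => F (g s)) t (dg * l).
Proof.
rewrite cderiv_iff, !rderiv_iff. intros HF Hg eps Heps.
set (M := (Cmod dg + 1)%R). set (L := (Cmod l + 1)%R).
assert (HM : (0 < M)%R) by (unfold M; pose proof (Cmod_ge_0 dg); lra).
assert (HL : (0 < L)%R) by (unfold L; pose proof (Cmod_ge_0 l); lra).
destruct (HF (eps / 2 / M)%R) as [d1 [Hd1 H1]]. { apply Rdiv_lt_0_compat; lra. }
destruct (Hg (Rmin 1 (eps / 2 / L))) as [d2 [Hd2 H2]].
{ apply Rmin_case; [lra|]. apply Rdiv_lt_0_compat; lra. }
exists (Rmin d2 (d1 / M)). split.
{ apply Rmin_case; [lra|]. apply Rdiv_lt_0_compat; lra. }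
intros s Hs.
assert (Hs2 : (Rabs (s - t) < d2)%R) by (eapply Rlt_le_trans; [exact Hs|apply Rmin_l]).
assert (Hs1 : (Rabs (s - t) < d1 / M)%R) by (eapply Rlt_le_trans; [exact Hs|apply Rmin_r]).
specialize (H2 s Hs2).
assert (Hbound : (Cmod (g s - g t) <= M * Rabs (s - t))%R).
{ replace (g s - g t) with ((g s - g t - RtoC (s - t) * dg) + RtoC (s - t) * dg) by ring.
  eapply Rle_trans; [apply Cmod_triangle|]. rewrite Cmod_mult, Cmod_R.
  assert (Rmin 1 (eps / 2 / L) * Rabs (s - t) <= 1 * Rabs (s - t))%R.
  { apply Rmult_le_compat_r; [apply Rabs_pos|apply Rmin_l]. }
  unfold M. lra. }
assert (Hlt : (Cmod (g s - g t) < d1)%R).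
{ eapply Rle_lt_trans; [exact Hbound|]. apply Rlt_div_r in Hs1; [|exact HM]. lra. }
specialize (H1 (g s) Hlt).
replace (F (g s) - F (g t) - RtoC (s - t) * (dg * l)) with
  ((F (g s) - F (g t) - (g s - g t) * l) + (g s - g t - RtoC (s - t) * dg) * l) by ring.
eapply Rle_trans; [apply Cmod_triangle|]. rewrite (Cmod_mult _ l).
assert (E1 : (eps / 2 / M * Cmod (g s - g t) <= eps / 2 * Rabs (s - t))%R).
{ replace (eps / 2 * Rabs (s - t))%R with (eps / 2 / M * (M * Rabs (s - t)))%R by (field; lra).
  apply Rmult_le_compat_l; [|exact Hbound]. apply Rlt_le, Rdiv_lt_0_compat; lra. }
assert (E2 : (Cmod (g s - g t - RtoC (s - t) * dg) * Cmod l <= eps / 2 * Rabs (s - t))%R).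
{ apply Rle_trans with ((eps / 2 / L * Rabs (s - t)) * L)%R.
  - apply Rmult_le_compat; try apply Cmod_ge_0; [|unfold L; lra].
    eapply Rle_trans; [exact H2|]. apply Rmult_le_compat_r; [apply Rabs_pos|apply Rmin_r].
  - right. field. lra. }
lra.
Qed.

Lemma cderiv_unique f x l l' : cderiv f x l -> cderiv f x l' -> l = l'.
Proof.
intros H H'. apply is_C_derive_unique in H, H'. congruence.
Qed.

Lemma cderiv_continuous f x l : cderiv f x l ->
  continuous (T := C_UniformSpace) (U := C_UniformSpace) f x.
Proof.
rewrite cderiv_iff, continuous_C_iff. intros H eps Heps.
destruct (H 1%R Rlt_0_1) as [d [Hd0 Hd]].
assert (HL : (0 < Cmod l + 1)%R) by (pose proof (Cmod_ge_0 l); lra).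
exists (Rmin d (eps / (Cmod l + 1))). split.
{ apply Rmin_case; [lra|]. apply Rdiv_lt_0_compat; lra. }
intros y Hy.
assert (Hy1 := Rlt_le_trans _ _ _ Hy (Rmin_l _ _)).
assert (Hy2 := Rlt_le_trans _ _ _ Hy (Rmin_r _ _)).
apply Rlt_div_r in Hy2; [|exact HL].
specialize (Hd y Hy1).
replace (f y - f x) with ((f y - f x - (y - x) * l) + (y - x) * l) by ring.
eapply Rle_lt_trans; [apply Cmod_triangle|]. rewrite (Cmod_mult _ l). lra.
Qed.

Lemma cderiv_inv (x : C) : x <> 0 -> cderiv Cinv x (- / (x * x)).
Proof.
intros Hx. apply cderiv_iff. intros eps Heps.
assert (Hm := proj1 (Cmod_gt_0 x) Hx). set (m := Cmod x) in *.
(* The remainder is [(y - x) ^ 2 / (x ^ 2 * y)]. The first bound keeps [Cmod y] at least [m / 2], so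
   the denominator is at least [m ^ 3 / 2]; the second bound absorbs one factor [y - x]. *)
exists (Rmin (m / 2) (eps * m ^ 3 / 2)). split.
{ apply Rmin_case; [lra|]. assert (0 < m ^ 3)%R by (apply pow_lt; lra).
  apply Rdiv_lt_0_compat; [apply Rmult_lt_0_compat|]; lra. }
intros y Hy.
assert (Hy1 := Rlt_le_trans _ _ _ Hy (Rmin_l _ _)).
assert (Hy2 := Rlt_le_trans _ _ _ Hy (Rmin_r _ _)).
assert (Hmy : (m / 2 <= Cmod y)%R).
{ assert (m <= Cmod y + Cmod (y - x))%R; [|lra].
  unfold m. replace x with (y + - (y - x)) at 1 by ring.
  eapply Rle_trans; [apply Cmod_triangle|]. rewrite Cmod_opp. lra. }
assert (Hy0 : y <> 0). { apply Cmod_gt_0. lra. }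
replace (/ y - / x - (y - x) * - / (x * x)) with ((y - x) * ((y - x) * / (x * x * y))) by (field; auto).
rewrite Cmod_mult, Rmult_comm. apply Rmult_le_compat_r; [apply Cmod_ge_0|].
rewrite Cmod_mult, Cmod_inv, !Cmod_mult by (repeat apply Cmult_neq_0; auto). fold m.
apply Rle_trans with ((eps * m ^ 3 / 2) * / (m * m * (m / 2)))%R.
- apply Rmult_le_compat; try apply Cmod_ge_0; [|lra|].
  + apply Rlt_le, Rinv_0_lt_compat. repeat apply Rmult_lt_0_compat; lra.
  + apply Rinv_le_contravar. repeat apply Rmult_lt_0_compat; lra.
    apply Rmult_le_compat_l; [|lra]. apply Rlt_le, Rmult_lt_0_compat; lra.
- right. field. lra.
Qed.

Lemma cderiv_comp (f g : C -> C) x l dg : cderiv f (g x) l -> cderiv g x dg ->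
  cderiv (fun y => f (g y)) x (dg * l).
Proof.
intros H1 H2. apply is_derive_C_AbsRing in H2.
exact (is_derive_comp (K:=C_AbsRing) (V:=C_NormedModule) f g x l dg H1 H2).
Qed.

Lemma cderiv_ext_loc (f g : C -> C) x l (d : R) : (0 < d)%R ->
  (forall y, (Cmod (y - x) < d)%R -> f y = g y) -> cderiv f x l -> cderiv g x l.
Proof.
intros Hd0 Hd H. apply (is_derive_ext_loc (K:=C_AbsRing) (V:=C_NormedModule) f g x l); [|exact H].
exists (mkposreal d Hd0). exact Hd.
Qed.

Lemma cderiv_shift (p w : C) : cderiv (fun z => z - p) w 1.
Proof.
replace (RtoC 1) with (1 + 0) by ring.
apply (cderiv_plus (fun z => z) (fun _ => - p)); [apply cderiv_id|apply cderiv_const].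
Qed.

Lemma cderiv_scal (c : C) (f : C -> C) (x l : C) : cderiv f x l -> cderiv (fun z => c * f z) x (c * l).
Proof.
intros H. replace (c * l) with (0 * f x + c * l) by ring.
apply (cderiv_mult (fun _ => c)); [apply cderiv_const|exact H].
Qed.

Lemma cderiv_minus (f g : C -> C) (x df dg : C) :
  cderiv f x df -> cderiv g x dg -> cderiv (fun y => f y - g y) x (df - dg).
Proof. exact (is_derive_minus f g x df dg). Qed.

(** * Integrals along segments *)

Lemma continuous_Cmult {U : UniformSpace} (f g : U -> C) (x : U) :
  continuous (U := C_UniformSpace) f x -> continuous (U := C_UniformSpace) g x ->
  continuous (U := C_UniformSpace) (fun y => f y * g y) x.
Proof.
intros Hf Hg.
apply (continuous_scal (K := C_AbsRing) (V := C_NormedModule) f g x); [|exact Hg].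
intros P HP. apply Hf. apply locally_C. exact HP.
Qed.

Lemma continuous_Cinv {U : UniformSpace} (f : U -> C) (x : U) : f x <> 0 ->
  continuous (U := C_UniformSpace) f x -> continuous (U := C_UniformSpace) (fun y => / f y) x.
Proof.
intros Hn Hf.
apply (continuous_comp (V := C_UniformSpace) (W := C_UniformSpace) f Cinv x Hf).
exact (cderiv_continuous _ _ _ (cderiv_inv _ Hn)).
Qed.

Lemma continuous_Cplus {U : UniformSpace} (f g : U -> C) (x : U) :
  continuous (U := C_UniformSpace) f x -> continuous (U := C_UniformSpace) g x ->
  continuous (U := C_UniformSpace) (fun y => f y + g y) x.
Proof. exact (continuous_plus (V := C_NormedModule) f g x). Qed.

Lemma continuous_Cminus {U : UniformSpace} (f g : U -> C) (x : U) :
  continuous (U := C_UniformSpace) f x -> continuous (U := C_UniformSpace) g x ->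
  continuous (U := C_UniformSpace) (fun y => f y - g y) x.
Proof. exact (continuous_minus (V := C_NormedModule) f g x). Qed.

Lemma rderiv_continuous (g : R -> C) (t : R) (l : C) : rderiv g t l ->
  continuous (U := C_UniformSpace) g t.
Proof.
intros H. apply (ex_derive_continuous (K := R_AbsRing) (V := C_R_NormedModule) g t). exists l; exact H.
Qed.

(* Coquelicot states equalities in the carrier of an algebraic structure, which hides [C] from [ring]. *)
Ltac Ceq := match goal with |- @eq _ ?u ?v => change (@eq C u v) end.

Definition seg (a b : C) (t : R) : C := a + RtoC t * (b - a).

Lemma rderiv_seg (a b : C) (t : R) : rderiv (seg a b) t (b - a).
Proof.
apply rderiv_iff. intros eps Heps. exists 1%R; split; [lra|]. intros s _.
replace (seg a b s - seg a b t - RtoC (s - t) * (b - a)) with (RtoC 0).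
- rewrite Cmod_0. apply Rmult_le_pos; [lra|apply Rabs_pos].
- unfold seg. rewrite RtoC_minus. ring.
Qed.

Lemma seg_0 a b : seg a b 0 = a.
Proof. unfold seg. ring. Qed.

Lemma seg_1 a b : seg a b 1 = b.
Proof. unfold seg. ring. Qed.

Definition cont_at (f : C -> C) (x : C) : Prop :=
  continuous (T := C_UniformSpace) (U := C_UniformSpace) f x.

Definition seg_integral (f : C -> C) (a b : C) : C :=
  RInt (V := C_R_CompleteNormedModule) (fun t => (b - a) * f (seg a b t)) 0 1.

Definition cont_on_seg (f : C -> C) (a b : C) : Prop :=
  forall t : R, (0 <= t <= 1)%R -> cont_at f (seg a b t).

Lemma continuous_on_seg (f : C -> C) (a b : C) (t : R) : cont_at f (seg a b t) ->
  continuous (U := C_UniformSpace) (fun t => (b - a) * f (seg a b t)) t.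
Proof.
intros H. apply continuous_Cmult; [apply continuous_const|].
apply (continuous_comp (V := C_UniformSpace) (W := C_UniformSpace) (seg a b) f t); [|exact H].
exact (rderiv_continuous _ _ _ (rderiv_seg a b t)).
Qed.

Lemma seg_integral_correct (f : C -> C) (a b : C) : cont_on_seg f a b ->
  is_RInt (V := C_R_NormedModule) (fun t => (b - a) * f (seg a b t)) 0 1 (seg_integral f a b).
Proof.
intros H. apply (RInt_correct (V := C_R_CompleteNormedModule)).
apply (ex_RInt_continuous (V := C_R_CompleteNormedModule)).
intros t Ht. rewrite Rmin_left, Rmax_right in Ht by lra.
apply continuous_on_seg, H, Ht.
Qed.

Lemma seg_integral_le (f : C -> C) (a b : C) (M : R) : cont_on_seg f a b ->
  (forall t, (0 <= t <= 1)%R -> (Cmod (f (seg a b t)) <= M)%R) ->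
  (Cmod (seg_integral f a b) <= M * Cmod (b - a))%R.
Proof.
intros Hc HM. rewrite Cmod_norm.
replace (M * Cmod (b - a))%R with ((1 - 0) * (Cmod (b - a) * M))%R by ring.
apply (norm_RInt_le_const (V := C_R_NormedModule) (fun t => (b - a) * f (seg a b t)) 0 1); [lra| |apply seg_integral_correct, Hc].
intros t Ht. rewrite norm_C_R, Cmod_mult. apply Rmult_le_compat_l; [apply Cmod_ge_0|apply HM, Ht].
Qed.

Lemma seg_integral_plus (f g : C -> C) (a b : C) : cont_on_seg f a b -> cont_on_seg g a b ->
  seg_integral (fun z => f z + g z) a b = seg_integral f a b + seg_integral g a b.
Proof.
intros Hf Hg. apply (is_RInt_unique (V := C_R_CompleteNormedModule)).
apply (is_RInt_ext (V := C_R_NormedModule) (fun t => plus ((b - a) * f (seg a b t)) ((b - a) * g (seg a b t)))).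
- intros t _. Ceq. change (plus ?u ?v) with (u + v). ring.
- apply (is_RInt_plus (V := C_R_NormedModule)); apply seg_integral_correct; assumption.
Qed.

Lemma seg_integral_primitive (Q f : C -> C) (a b : C) : cont_on_seg f a b ->
  (forall t, (0 <= t <= 1)%R -> cderiv Q (seg a b t) (f (seg a b t))) ->
  seg_integral f a b = Q b - Q a.
Proof.
intros Hf HQ. apply (is_RInt_unique (V := C_R_CompleteNormedModule)).
replace (Q b - Q a) with (minus (Q (seg a b 1)) (Q (seg a b 0))) by (rewrite seg_0, seg_1; reflexivity).
apply (is_RInt_derive (V := C_R_CompleteNormedModule) (fun t => Q (seg a b t))); intros t Ht; rewrite Rmin_left, Rmax_right in Ht by lra.
- apply cderiv_comp_curve; [apply HQ, Ht|apply rderiv_seg].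
- apply continuous_on_seg, Hf, Ht.
Qed.

Lemma seg_integral_rev (f : C -> C) (a b : C) : cont_on_seg f a b ->
  seg_integral f b a = - seg_integral f a b.
Proof.
intros Hf. unfold seg_integral at 1.
rewrite (RInt_ext (V := C_R_CompleteNormedModule) _ (fun s => scal (-1)%R ((b - a) * f (seg a b (-1 * s + 1))))).
- rewrite (RInt_comp_lin (V := C_R_CompleteNormedModule) (fun t => (b - a) * f (seg a b t))).
  + replace (-1 * 0 + 1)%R with 1%R by ring. replace (-1 * 1 + 1)%R with 0%R by ring.
    rewrite <- (opp_RInt_swap (V := C_R_CompleteNormedModule)); [reflexivity|].
    eexists; apply seg_integral_correct, Hf.
  + replace (-1 * 0 + 1)%R with 1%R by ring. replace (-1 * 1 + 1)%R with 0%R by ring.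
    apply ex_RInt_swap. eexists; apply seg_integral_correct, Hf.
- intros s _. Ceq. rewrite (scal_R_Cmult (-1) _).
  replace (seg a b (-1 * s + 1)) with (seg b a s); [ring|].
  unfold seg. rewrite RtoC_plus, RtoC_mult. ring.
Qed.

Definition midpoint (a b : C) : C := (a + b) / 2.

Lemma seg_integral_half (f : C -> C) (a b : C) : cont_on_seg f a b ->
  seg_integral f a b = seg_integral f a (midpoint a b) + seg_integral f (midpoint a b) b.
Proof.
intros Hf.
assert (Hex : ex_RInt (V := C_R_NormedModule) (fun t => (b - a) * f (seg a b t)) 0 1).
{ eexists; apply seg_integral_correct, Hf. }
assert (H2 : RtoC 2 <> 0) by (intros H; apply RtoC_inj in H; lra).
assert (E0 : (1 / 2 * 0 + 0 = 0)%R) by ring.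
assert (E1 : (1 / 2 * 1 + 0 = 1 / 2)%R) by ring.
assert (E2 : (1 / 2 * 0 + 1 / 2 = 1 / 2)%R) by ring.
assert (E3 : (1 / 2 * 1 + 1 / 2 = 1)%R) by lra.
assert (Hex1 : ex_RInt (V := C_R_NormedModule) (fun t => (b - a) * f (seg a b t)) 0 (1 / 2)).
{ apply (ex_RInt_Chasles_1 (V := C_R_CompleteNormedModule)) with 1%R; [lra|exact Hex]. }
assert (Hex2 : ex_RInt (V := C_R_NormedModule) (fun t => (b - a) * f (seg a b t)) (1 / 2) 1).
{ apply (ex_RInt_Chasles_2 (V := C_R_CompleteNormedModule)) with 0%R; [lra|exact Hex]. }
unfold seg_integral.
rewrite <- (RInt_Chasles (V := C_R_CompleteNormedModule) _ 0 (1 / 2) 1) by assumption.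
apply (f_equal2 Cplus).
- pose proof (RInt_comp_lin (V := C_R_CompleteNormedModule) (fun t => (b - a) * f (seg a b t)) (1 / 2) 0 0 1) as H.
  rewrite E0, E1 in H. rewrite <- H by exact Hex1.
  apply (RInt_ext (V := C_R_CompleteNormedModule)). intros s _. Ceq. rewrite (scal_R_Cmult (1 / 2) _).
  replace (seg a b (1 / 2 * s + 0)) with (seg a (midpoint a b) s).
  + unfold midpoint. rewrite RtoC_div by lra. field.
  + unfold seg, midpoint. rewrite RtoC_plus, RtoC_mult, RtoC_div by lra. field.
- pose proof (RInt_comp_lin (V := C_R_CompleteNormedModule) (fun t => (b - a) * f (seg a b t)) (1 / 2) (1 / 2) 0 1) as H.
  rewrite E2, E3 in H. rewrite <- H by exact Hex2.
  apply (RInt_ext (V := C_R_CompleteNormedModule)). intros s _. Ceq. rewrite (scal_R_Cmult (1 / 2) _).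
  replace (seg a b (1 / 2 * s + 1 / 2)) with (seg (midpoint a b) b s).
  + unfold midpoint. rewrite RtoC_div by lra. field.
  + unfold seg, midpoint. rewrite RtoC_plus, RtoC_mult, RtoC_div by lra. field.
Qed.

(** * Goursat's lemma *)

(** [2 * (D / 2 ^ n)] bounds the sum of all steps from the [n]-th on. Hence the intervals of this
    radius around [u n] are nested, and the supremum of their left ends lies in each of them. *)
Lemma real_geometric_limit (u : nat -> R) (D : R) :
  (forall n, (Rabs (u (S n) - u n) <= D / 2 ^ n)%R) ->
  exists s : R, forall n, (Rabs (s - u n) <= 2 * (D / 2 ^ n))%R.
Proof.
intros Hu.
assert (Hstep : forall n, (2 * (D / 2 ^ S n) = D / 2 ^ n)%R).
{ intros n. simpl. field. apply pow_nonzero; lra. }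
assert (Hmono : forall n k, (u n - 2 * (D / 2 ^ n) <= u (n + k)%nat - 2 * (D / 2 ^ (n + k)))%R /\
   (u (n + k)%nat + 2 * (D / 2 ^ (n + k)) <= u n + 2 * (D / 2 ^ n))%R).
{ intros n k. induction k as [|k IH].
  - rewrite Nat.add_0_r. lra.
  - rewrite Nat.add_succ_r. specialize (Hu (n + k)%nat). specialize (Hstep (n + k)%nat).
    apply Rabs_le_between in Hu. lra. }
assert (H0 : (0 <= D)%R).
{ specialize (Hu 0%nat). pose proof (Rabs_pos (u 1%nat - u 0%nat)). simpl in Hu. lra. }
assert (Hd : forall n, (0 <= D / 2 ^ n)%R).
{ intros n. apply Rdiv_le_0_compat; [lra|]. apply pow_lt; lra. }
assert (Hcross : forall m n, (u n - 2 * (D / 2 ^ n) <= u m + 2 * (D / 2 ^ m))%R).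
{ intros m n. destruct (Hmono n m) as [H1 _]. destruct (Hmono m n) as [_ H2].
  rewrite (Nat.add_comm m n) in H2. pose proof (Hd (n + m)%nat). lra. }
destruct (completeness (fun x => exists n, x = (u n - 2 * (D / 2 ^ n))%R)) as [s [Hs1 Hs2]].
- exists (u 0%nat + 2 * (D / 2 ^ 0))%R. intros x [n ->]. apply Hcross.
- exists (u 0%nat - 2 * (D / 2 ^ 0))%R. exists 0%nat. reflexivity.
- exists s. intros n. apply Rabs_le_between. split.
  + assert (u n - 2 * (D / 2 ^ n) <= s)%R by (apply Hs1; exists n; reflexivity). lra.
  + assert (s <= u n + 2 * (D / 2 ^ n))%R by (apply Hs2; intros x [k ->]; apply Hcross). lra.
Qed.

Lemma im_le_Cmod (z : C) : (Rabs (Im z) <= Cmod z)%R.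
Proof. eapply Rle_trans; [apply Rmax_r|apply Rmax_Cmod]. Qed.

Lemma Cmod_le_re_im (z : C) : (Cmod z <= Rabs (Re z) + Rabs (Im z))%R.
Proof.
replace z with (RtoC (Re z) + RtoC (Im z) * Ci) at 1.
- eapply Rle_trans; [apply Cmod_triangle|]. rewrite Cmod_mult, Cmod_Ci, !Cmod_R. lra.
- destruct z; unfold RtoC, Ci, Cmult, Cplus; simpl; f_equal; ring.
Qed.

Lemma complex_geometric_limit (u : nat -> C) (D : R) :
  (forall n, (Cmod (u (S n) - u n) <= D / 2 ^ n)%R) ->
  exists p : C, forall n, (Cmod (u n - p) <= 4 * (D / 2 ^ n))%R.
Proof.
intros Hu.
destruct (real_geometric_limit (fun n => Re (u n)) D) as [x Hx].
{ intros n. eapply Rle_trans; [|apply Hu]. eapply Rle_trans; [|apply re_le_Cmod].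
  right. f_equal. }
destruct (real_geometric_limit (fun n => Im (u n)) D) as [y Hy].
{ intros n. eapply Rle_trans; [|apply Hu]. eapply Rle_trans; [|apply im_le_Cmod].
  right. f_equal. }
exists (x, y). intros n. specialize (Hx n). specialize (Hy n).
eapply Rle_trans; [apply Cmod_le_re_im|].
rewrite Rabs_minus_sym in Hx, Hy.
replace (Re (u n - (x, y))) with (Re (u n) - x)%R by reflexivity.
replace (Im (u n - (x, y))) with (Im (u n) - y)%R by reflexivity. lra.
Qed.

Definition Cconvex (V : C -> Prop) : Prop :=
  forall a b t, V a -> V b -> (0 <= t <= 1)%R -> V (seg a b t).

Definition Cclosed (V : C -> Prop) : Prop :=
  forall p, (forall eps : R, (0 < eps)%R -> exists x, V x /\ (Cmod (x - p) < eps)%R) -> V p.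

Definition holomorphic_on (V : C -> Prop) (f : C -> C) : Prop :=
  forall z, V z -> exists l, cderiv f z l.

Lemma holomorphic_cont_on_seg V f a b : Cconvex V -> holomorphic_on V f -> V a -> V b ->
  cont_on_seg f a b.
Proof.
intros HV Hf Ha Hb t Ht. destruct (Hf (seg a b t)) as [l Hl]; [apply HV; assumption|].
exact (cderiv_continuous _ _ _ Hl).
Qed.

Definition triangle : Type := (C * C * C)%type.

Definition triangle_integral (f : C -> C) (T : triangle) : C :=
  let '(a, b, c) := T in seg_integral f a b + seg_integral f b c + seg_integral f c a.

Definition triangle_in (V : C -> Prop) (T : triangle) : Prop :=
  let '(a, b, c) := T in V a /\ V b /\ V c.

Definition triangle_size (T : triangle) (d : R) : Prop :=
  let '(a, b, c) := T in
  (Cmod (b - a) <= d)%R /\ (Cmod (c - b) <= d)%R /\ (Cmod (a - c) <= d)%R.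

(** The marked vertex whose positions under repeated bisection form the convergent sequence. *)
Definition corner (T : triangle) : C := fst (fst T).

Lemma midpoint_seg a b : midpoint a b = seg a b (1 / 2).
Proof. unfold midpoint, seg. rewrite RtoC_div by lra. field. Qed.

Lemma Cmod_half (z : C) (d : R) : (Cmod z <= d)%R -> (Cmod (z / 2) <= d / 2)%R.
Proof.
intros H. rewrite Cmod_div by (intros E; apply RtoC_inj in E; lra).
rewrite Cmod_R, (Rabs_pos_eq 2) by lra. lra.
Qed.

(** The midpoints cut the triangle into four of half the size. In the sum of the four integrals the
    inner edges cancel, so one of them carries at least a quarter of the total. *)
Lemma triangle_bisection V f T : Cconvex V -> holomorphic_on V f -> triangle_in V T ->
  exists T', triangle_in V T' /\
   (forall d, triangle_size T d -> triangle_size T' (d / 2) /\ (Cmod (corner T' - corner T) <= d)%R) /\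
   (Cmod (triangle_integral f T) <= 4 * Cmod (triangle_integral f T'))%R.
Proof.
intros HV Hf. destruct T as [[a b] c]. intros (Ha & Hb & Hc).
set (p := midpoint a b). set (q := midpoint b c). set (r := midpoint c a).
assert (Vp : V p) by (unfold p; rewrite midpoint_seg; apply HV; try assumption; lra).
assert (Vq : V q) by (unfold q; rewrite midpoint_seg; apply HV; try assumption; lra).
assert (Vr : V r) by (unfold r; rewrite midpoint_seg; apply HV; try assumption; lra).
assert (Hcs : forall x y, V x -> V y -> cont_on_seg f x y).
{ intros x y Hx Hy. exact (holomorphic_cont_on_seg V f x y HV Hf Hx Hy). }
assert (E : triangle_integral f (a, b, c) =
  triangle_integral f (a, p, r) + triangle_integral f (p, b, q) +
  (triangle_integral f (r, q, c) + triangle_integral f (p, q, r))).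
{ simpl. rewrite (seg_integral_half f a b), (seg_integral_half f b c), (seg_integral_half f c a) by auto.
  fold p q r.
  rewrite (seg_integral_rev f q p), (seg_integral_rev f r p), (seg_integral_rev f r q) by auto. ring. }
assert (Hsize : forall d, triangle_size (a, b, c) d ->
   (Cmod (p - a) <= d / 2 /\ Cmod (b - p) <= d / 2 /\ Cmod (q - b) <= d / 2 /\ Cmod (c - q) <= d / 2 /\
   Cmod (r - c) <= d / 2 /\ Cmod (a - r) <= d / 2 /\ Cmod (r - p) <= d / 2 /\ Cmod (q - p) <= d / 2 /\
   Cmod (q - r) <= d / 2)%R).
{ intros d (H1 & H2 & H3).
  assert (H1' : (Cmod (a - b) <= d)%R) by (rewrite <- Cmod_opp; replace (- (a - b)) with (b - a) by ring; exact H1).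
  assert (H2' : (Cmod (b - c) <= d)%R) by (rewrite <- Cmod_opp; replace (- (b - c)) with (c - b) by ring; exact H2).
  assert (H3' : (Cmod (c - a) <= d)%R) by (rewrite <- Cmod_opp; replace (- (c - a)) with (a - c) by ring; exact H3).
  apply Cmod_half in H1, H2, H3, H1', H2', H3'. unfold p, q, r, midpoint.
  repeat split.
  - replace ((a + b) / 2 - a) with ((b - a) / 2) by field. exact H1.
  - replace (b - (a + b) / 2) with ((b - a) / 2) by field. exact H1.
  - replace ((b + c) / 2 - b) with ((c - b) / 2) by field. exact H2.
  - replace (c - (b + c) / 2) with ((c - b) / 2) by field. exact H2.
  - replace ((c + a) / 2 - c) with ((a - c) / 2) by field. exact H3.
  - replace (a - (c + a) / 2) with ((a - c) / 2) by field. exact H3.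
  - replace ((c + a) / 2 - (a + b) / 2) with ((c - b) / 2) by field. exact H2.
  - replace ((b + c) / 2 - (a + b) / 2) with ((c - a) / 2) by field. exact H3'.
  - replace ((b + c) / 2 - (c + a) / 2) with ((b - a) / 2) by field. exact H1. }
assert (Hsym : forall x y, Cmod (x - y) = Cmod (y - x)).
{ intros x y. rewrite <- Cmod_opp. f_equal. ring. }
assert (Hpos : forall d, triangle_size (a, b, c) d -> (0 <= d)%R).
{ intros d (H1 & _). pose proof (Cmod_ge_0 (b - a)). lra. }
set (N := Cmod (triangle_integral f (a, b, c))).
assert (HN : (N <= Cmod (triangle_integral f (a, p, r)) + Cmod (triangle_integral f (p, b, q)) +
  (Cmod (triangle_integral f (r, q, c)) + Cmod (triangle_integral f (p, q, r))))%R).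
{ unfold N. rewrite E. eapply Rle_trans; [apply Cmod_triangle|]. apply Rplus_le_compat; apply Cmod_triangle. }
destruct (Rle_or_lt N (4 * Cmod (triangle_integral f (a, p, r)))) as [L|L1].
{ exists (a, p, r). split; [repeat split; assumption|]. split; [|exact L].
  intros d Hd. specialize (Hpos d Hd). apply Hsize in Hd. unfold corner; simpl. split.
  - rewrite (Hsym r p), (Hsym p r). tauto.
  - replace (a - a) with (RtoC 0) by ring. rewrite Cmod_0. exact Hpos. }
destruct (Rle_or_lt N (4 * Cmod (triangle_integral f (p, b, q)))) as [L|L2].
{ exists (p, b, q). split; [repeat split; assumption|]. split; [|exact L].
  intros d Hd. specialize (Hpos d Hd). apply Hsize in Hd. unfold corner; simpl. split.
  - rewrite (Hsym p q). tauto.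
  - lra. }
destruct (Rle_or_lt N (4 * Cmod (triangle_integral f (r, q, c)))) as [L|L3].
{ exists (r, q, c). split; [repeat split; assumption|]. split; [|exact L].
  intros d Hd. specialize (Hpos d Hd). apply Hsize in Hd. unfold corner; simpl. split.
  - tauto.
  - rewrite (Hsym r a). lra. }
exists (p, q, r). split; [repeat split; assumption|]. split.
- intros d Hd. specialize (Hpos d Hd). apply Hsize in Hd. unfold corner; simpl. split.
  + rewrite (Hsym r q), (Hsym p r). tauto.
  + lra.
- fold N. lra.
Qed.

Lemma seg_near_corner (a b c : C) (d t : R) : (0 <= t <= 1)%R ->
  (Cmod (b - a) <= d)%R -> (Cmod (c - a) <= d)%R -> (Cmod (seg b c t - a) <= d)%R.
Proof.
intros Ht Hb Hc.
replace (seg b c t - a) with (RtoC (1 - t) * (b - a) + RtoC t * (c - a)).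
- eapply Rle_trans; [apply Cmod_triangle|]. rewrite !Cmod_mult, !Cmod_R, !Rabs_pos_eq by lra.
  apply Rle_trans with ((1 - t) * d + t * d)%R; [|lra].
  apply Rplus_le_compat; apply Rmult_le_compat_l; lra.
- unfold seg. rewrite RtoC_minus. ring.
Qed.

(** Each bisection costs a factor [4] in the integral and gains [1 / 2] in the side length. Near the
    limit point the integral is small of higher order than the square of the side, so the two
    balance only if the integral is [0]. Closedness of [V] puts the limit point where [f] is
    differentiable. *)
Lemma Goursat V f a b c : Cconvex V -> Cclosed V -> holomorphic_on V f ->
  V a -> V b -> V c -> triangle_integral f (a, b, c) = 0.
Proof.
intros HV HVc Hf Ha Hb Hc.
(* The condition on [T] stands under the existential quantifier, so that choice yields a total
   function [next]. *)
assert (Hex : forall T, exists T', triangle_in V T -> triangle_in V T' /\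
   (forall d, triangle_size T d -> triangle_size T' (d / 2) /\ (Cmod (corner T' - corner T) <= d)%R) /\
   (Cmod (triangle_integral f T) <= 4 * Cmod (triangle_integral f T'))%R).
{ intros T. destruct (classic (triangle_in V T)) as [HT|HT].
  - destruct (triangle_bisection V f T HV Hf HT) as [T' HT']. exists T'. intros _. exact HT'.
  - exists T. intros H. contradiction. }
set (next := fun T => proj1_sig (constructive_indefinite_description _ (Hex T))).
assert (Hnext : forall T, triangle_in V T -> triangle_in V (next T) /\
   (forall d, triangle_size T d -> triangle_size (next T) (d / 2) /\ (Cmod (corner (next T) - corner T) <= d)%R) /\
   (Cmod (triangle_integral f T) <= 4 * Cmod (triangle_integral f (next T)))%R).
{ intros T. exact (proj2_sig (constructive_indefinite_description _ (Hex T))). }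
set (T := fun n => Nat.iter n next (a, b, c)).
set (D := (Cmod (b - a) + Cmod (c - b) + Cmod (a - c))%R).
assert (HD : (0 <= D)%R).
{ unfold D. pose proof (Cmod_ge_0 (b - a)). pose proof (Cmod_ge_0 (c - b)). pose proof (Cmod_ge_0 (a - c)). lra. }
assert (HT : forall n, triangle_in V (T n) /\ triangle_size (T n) (D / 2 ^ n) /\
  (Cmod (triangle_integral f (a, b, c)) <= 4 ^ n * Cmod (triangle_integral f (T n)))%R).
{ induction n as [|n (IH1 & IH2 & IH3)].
  - split; [|split].
    + repeat split; assumption.
    + unfold D; simpl. pose proof (Cmod_ge_0 (b - a)). pose proof (Cmod_ge_0 (c - b)).
      pose proof (Cmod_ge_0 (a - c)). repeat split; lra.
    + simpl (4 ^ 0)%R. rewrite Rmult_1_l. apply Rle_refl.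
  - destruct (Hnext (T n) IH1) as (H1 & H2 & H3). destruct (H2 _ IH2) as [H4 _].
    change (next (T n)) with (T (S n)) in *. split; [|split].
    + exact H1.
    + replace (D / 2 ^ S n)%R with (D / 2 ^ n / 2)%R; [exact H4|].
      simpl. field. apply pow_nonzero; lra.
    + eapply Rle_trans; [exact IH3|]. simpl (4 ^ S n)%R. rewrite (Rmult_comm 4), Rmult_assoc.
      apply Rmult_le_compat_l; [apply pow_le; lra|exact H3]. }
destruct (complex_geometric_limit (fun n => corner (T n)) D) as [p Hp].
{ intros n. destruct (HT n) as (H1 & H2 & _). destruct (Hnext (T n) H1) as (_ & H3 & _).
  apply H3, H2. }
(* With [d = D / 2 ^ n], the limit is within [4 * d] of the corner and the sides are within [d] of
   it, which makes [5 * d]. *)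
assert (Hsmall : forall eps : R, (0 < eps)%R -> exists n, (5 * (D / 2 ^ n) < eps)%R).
{ intros eps Heps. destruct (Pow_x_infinity 2 ltac:(rewrite Rabs_pos_eq; lra) (5 * D / eps + 1)) as [n Hn].
  exists n. specialize (Hn n (Nat.le_refl n)).
  rewrite Rabs_pos_eq in Hn by (apply pow_le; lra).
  assert (H2 : (0 < 2 ^ n)%R) by (apply pow_lt; lra).
  replace (5 * (D / 2 ^ n))%R with (5 * D / 2 ^ n)%R by (field; lra).
  apply Rlt_div_l; [exact H2|].
  assert (H3 : (5 * D / eps < 2 ^ n)%R) by lra. apply Rlt_div_l in H3; [|exact Heps]. lra. }
assert (HVp : V p).
{ apply HVc. intros eps Heps. destruct (Hsmall eps Heps) as [n Hn]. exists (corner (T n)). split.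
  - destruct (HT n) as (H1 & _). destruct (T n) as [[x y] z]. exact (proj1 H1).
  - eapply Rle_lt_trans; [apply Hp|]. assert (0 <= D / 2 ^ n)%R; [|lra].
    apply Rdiv_le_0_compat; [lra|]. apply pow_lt; lra. }
destruct (Hf p HVp) as [l Hl]. rewrite cderiv_iff in Hl.
apply Cmod_eq_0, Rle_antisym; [|apply Cmod_ge_0].
apply Rnot_lt_le. intros Hpos. set (m := Cmod (triangle_integral f (a, b, c))) in *.
(* Each of three sides contributes at most [eps * (5 * d) * d], and [4 ^ n * d ^ 2 = D ^ 2]. The
   choice makes [15 * eps * D ^ 2] smaller than [m], and the [+ 1] covers [D = 0]. *)
set (eps := (m / (15 * D * D + 1) / 2)%R).
assert (HDD : (0 <= D * D)%R) by (apply Rmult_le_pos; assumption).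
assert (Heps : (0 < eps)%R).
{ unfold eps. apply Rdiv_lt_0_compat; [|lra]. apply Rdiv_lt_0_compat; [exact Hpos|]. lra. }
destruct (Hl eps Heps) as [delta [Hdelta Hd]]. destruct (Hsmall delta Hdelta) as [n Hn].
destruct (HT n) as (H1 & H2 & H3). specialize (Hp n). simpl in Hp.
set (d := (D / 2 ^ n)%R) in *.
assert (Hdpos : (0 <= d)%R) by (apply Rdiv_le_0_compat; [lra|apply pow_lt; lra]).
destruct (T n) as [[x y] z]. unfold corner in Hp; simpl in Hp. simpl in H1. simpl in H2.
destruct H1 as (Vx & Vy & Vz). destruct H2 as (S1 & S2 & S3).
(* [f] is split at [p] into its affine part [A], whose primitive [B] telescopes around the triangle,
   and the error [e]. *)
set (e := fun w => f w - f p - l * (w - p)).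
set (A := fun w => f p + l * (w - p)).
set (B := fun w => f p * w + l / 2 * ((w - p) * (w - p))).
assert (HB : forall w, cderiv B w (A w)).
{ intros w. unfold A, B.
  replace (f p + l * (w - p)) with (f p * 1 + l / 2 * (1 * (w - p) + (w - p) * 1)) by field.
  apply cderiv_plus; [exact (cderiv_scal (f p) (fun w => w) w 1 (cderiv_id w))|].
  apply (cderiv_scal (l / 2) (fun w => (w - p) * (w - p))).
  exact (cderiv_mult (fun w => w - p) (fun w => w - p) w 1 1 (cderiv_shift p w) (cderiv_shift p w)). }
assert (HA : forall w, exists l, cderiv A w l).
{ intros w. exists (0 + l * 1). unfold A. apply cderiv_plus; [apply cderiv_const|].
  apply (cderiv_scal l (fun w => w - p)), cderiv_shift. }
assert (He : holomorphic_on V e).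
{ intros w Hw. destruct (Hf w Hw) as [k Hk]. exists (k - 0 - l * 1).
  apply (cderiv_minus (fun w => f w - f p)).
  - apply cderiv_minus; [exact Hk|apply cderiv_const].
  - apply (cderiv_scal l (fun w => w - p)), cderiv_shift. }
assert (HAc : forall u v, cont_on_seg A u v).
{ intros u v t _. destruct (HA (seg u v t)) as [k Hk]. exact (cderiv_continuous _ _ _ Hk). }
assert (Hsplit : forall u v, V u -> V v -> seg_integral f u v = (B v - B u) + seg_integral e u v).
{ intros u v Hu Hv. rewrite <- (seg_integral_primitive B A) by auto.
  rewrite <- seg_integral_plus; [|auto|exact (holomorphic_cont_on_seg V e u v HV He Hu Hv)].
  unfold seg_integral. apply (RInt_ext (V := C_R_CompleteNormedModule)).
  intros t _. Ceq. unfold A, e. ring. }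
assert (Hsym : forall u v, Cmod (u - v) = Cmod (v - u)).
{ intros u v. rewrite <- Cmod_opp. f_equal. ring. }
assert (Hbound : forall u v, V u -> V v -> (Cmod (v - u) <= d)%R -> (Cmod (u - x) <= d)%R -> (Cmod (v - x) <= d)%R ->
  (Cmod (seg_integral e u v) <= eps * (5 * d) * d)%R).
{ intros u v Hu Hv Huv Hux Hvx.
  apply Rle_trans with (eps * (5 * d) * Cmod (v - u))%R.
  - apply seg_integral_le; [exact (holomorphic_cont_on_seg V e u v HV He Hu Hv)|].
    intros t Ht.
    assert (Hz : (Cmod (seg u v t - p) <= 5 * d)%R).
    { replace (seg u v t - p) with ((seg u v t - x) + (x - p)) by ring.
      eapply Rle_trans; [apply Cmod_triangle|].
      pose proof (seg_near_corner x u v d t Ht Hux Hvx). lra. }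
    unfold e. rewrite (Cmult_comm l).
    eapply Rle_trans; [apply (Hd (seg u v t)); lra|].
    apply Rmult_le_compat_l; lra.
  - apply Rmult_le_compat_l; [|exact Huv]. apply Rmult_le_pos; lra. }
assert (Hx0 : (Cmod (x - x) <= d)%R).
{ replace (x - x) with (RtoC 0) by ring. rewrite Cmod_0. exact Hdpos. }
assert (Hzx : (Cmod (z - x) <= d)%R) by (rewrite Hsym; exact S3).
assert (HI : (Cmod (triangle_integral f (x, y, z)) <= 15 * eps * (d * d))%R).
{ simpl. rewrite !Hsplit by assumption.
  replace (B y - B x + seg_integral e x y + (B z - B y + seg_integral e y z) + (B x - B z + seg_integral e z x))
   with (seg_integral e x y + seg_integral e y z + seg_integral e z x) by ring.
  eapply Rle_trans; [apply Cmod_triangle|].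
  assert (I1 := Cmod_triangle (seg_integral e x y) (seg_integral e y z)).
  assert (I2 : (Cmod (seg_integral e x y) <= eps * (5 * d) * d)%R) by (apply Hbound; assumption).
  assert (I3 : (Cmod (seg_integral e y z) <= eps * (5 * d) * d)%R) by (apply Hbound; assumption).
  assert (I4 : (Cmod (seg_integral e z x) <= eps * (5 * d) * d)%R) by (apply Hbound; assumption).
  lra. }
assert (Hfin : (m <= 15 * eps * (D * D))%R).
{ eapply Rle_trans; [exact H3|].
  replace (15 * eps * (D * D))%R with (4 ^ n * (15 * eps * (d * d)))%R.
  - apply Rmult_le_compat_l; [apply pow_le; lra|exact HI].
  - unfold d. replace (4 ^ n)%R with (2 ^ n * 2 ^ n)%R by (rewrite <- Rpow_mult_distr; f_equal; ring).
    field. apply pow_nonzero; lra. }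
assert (Heq : (eps * (15 * D * D + 1) = m / 2)%R).
{ unfold eps. field. lra. }
nra.
Qed.

(** * Primitives *)

Definition Copen (U : C -> Prop) : Prop :=
  forall x, U x -> exists delta : R, (0 < delta)%R /\ forall y, (Cmod (y - x) < delta)%R -> U y.

(* The closed convex subset keeps the limit of a nested sequence of triangles inside [U]. *)
Definition Goursat_domain (U : C -> Prop) : Prop :=
  Copen U /\ Cconvex U /\
  forall a b c, U a -> U b -> U c ->
    exists V : C -> Prop, Cclosed V /\ Cconvex V /\ V a /\ V b /\ V c /\ (forall z, V z -> U z).

Lemma Goursat_domain_inter U1 U2 : Goursat_domain U1 -> Goursat_domain U2 ->
  Goursat_domain (fun z => U1 z /\ U2 z).
Proof.
intros (O1 & C1 & N1) (O2 & C2 & N2). split; [|split].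
- intros x [H1 H2]. destruct (O1 x H1) as [d1 [P1 Q1]]. destruct (O2 x H2) as [d2 [P2 Q2]].
  exists (Rmin d1 d2). split; [apply Rmin_case; assumption|]. intros y Hy. split.
  + apply Q1. eapply Rlt_le_trans; [exact Hy|apply Rmin_l].
  + apply Q2. eapply Rlt_le_trans; [exact Hy|apply Rmin_r].
- intros a b t [] [] Ht. split; [apply C1|apply C2]; assumption.
- intros a b c [Ha1 Ha2] [Hb1 Hb2] [Hc1 Hc2].
  destruct (N1 a b c) as (V1 & K1 & L1 & A1 & B1 & D1 & I1); try assumption.
  destruct (N2 a b c) as (V2 & K2 & L2 & A2 & B2 & D2 & I2); try assumption.
  exists (fun z => V1 z /\ V2 z). repeat split; try assumption.
  + apply K1. intros eps Heps. destruct (H eps Heps) as [x [[] Hx]]. exists x; auto.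
  + apply K2. intros eps Heps. destruct (H eps Heps) as [x [[] Hx]]. exists x; auto.
  + destruct H, H0; apply L1; assumption.
  + destruct H, H0; apply L2; assumption.
  + apply I1, H.
  + apply I2, H.
Qed.

Lemma Re_linear_seg (al be a b : C) (t : R) :
  Re (al * seg a b t + be) = ((1 - t) * Re (al * a + be) + t * Re (al * b + be))%R.
Proof.
unfold seg. destruct al, be, a, b. unfold Re, RtoC, Cmult, Cplus, Cminus, Copp; simpl. ring.
Qed.

Lemma Re_linear_near (al be x y : C) :
  (Rabs (Re (al * y + be) - Re (al * x + be)) <= Cmod al * Cmod (y - x))%R.
Proof.
rewrite <- Cmod_mult. eapply Rle_trans; [|apply re_le_Cmod]. right. f_equal.
destruct al, be, x, y. unfold Re, RtoC, Cmult, Cplus, Cminus, Copp; simpl. ring.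
Qed.

(** For three given points, the closed convex set is the half-plane where the same affine function
    is at least its minimum over the three. The case [al = 0] is included, hence the denominators
    [Cmod al + 1]. *)
Lemma Goursat_domain_half_plane (al be : C) : Goursat_domain (fun z => (0 < Re (al * z + be))%R).
Proof.
assert (HA : (0 < Cmod al + 1)%R) by (pose proof (Cmod_ge_0 al); lra).
assert (Hnear : forall eps x y, (0 < eps)%R -> (Cmod (y - x) < eps / (Cmod al + 1))%R ->
  (Rabs (Re (al * y + be) - Re (al * x + be)) < eps)%R).
{ intros eps x y Heps Hy. apply Rlt_div_r in Hy; [|exact HA].
  eapply Rle_lt_trans; [apply Re_linear_near|]. pose proof (Cmod_ge_0 (y - x)). lra. }
split; [|split].
- intros x Hx. exists (Re (al * x + be) / (Cmod al + 1))%R. split; [apply Rdiv_lt_0_compat; assumption|].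
  intros y Hy. apply Hnear in Hy; [|exact Hx]. apply Rabs_lt_between in Hy. lra.
- intros a b t Ha Hb Ht. rewrite Re_linear_seg. destruct (Rle_or_lt t (1 / 2)); nra.
- intros a b c Ha Hb Hc.
  set (m := Rmin (Re (al * a + be)) (Rmin (Re (al * b + be)) (Re (al * c + be)))).
  assert (Hm : (0 < m)%R) by (unfold m; repeat apply Rmin_case; assumption).
  exists (fun z => (m <= Re (al * z + be))%R). repeat split.
  + intros p Hp. apply Rnot_lt_le. intros Hlt.
    destruct (Hp ((m - Re (al * p + be)) / (Cmod al + 1))%R) as [x [Hx Hxp]].
    { apply Rdiv_lt_0_compat; lra. }
    apply Hnear in Hxp; [|lra]. apply Rabs_lt_between in Hxp. lra.
  + intros u v t Hu Hv Ht. rewrite Re_linear_seg. nra.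
  + apply Rmin_l.
  + eapply Rle_trans; [apply Rmin_r|apply Rmin_l].
  + eapply Rle_trans; [apply Rmin_r|apply Rmin_r].
  + intros z Hz. lra.
Qed.

Lemma seg_near (x y : C) (t : R) : (0 <= t <= 1)%R -> (Cmod (seg x y t - x) <= Cmod (y - x))%R.
Proof.
intros Ht. replace (seg x y t - x) with (RtoC t * (y - x)) by (unfold seg; ring).
rewrite Cmod_mult, Cmod_R, Rabs_pos_eq by lra.
pose proof (Cmod_ge_0 (y - x)). nra.
Qed.

Lemma seg_integral_const (c a b : C) : seg_integral (fun _ => c) a b = c * (b - a).
Proof.
rewrite (seg_integral_primitive (fun w => c * w) (fun _ => c)).
- ring.
- intros t _. apply continuous_const.
- intros t _. pose proof (cderiv_scal c (fun w => w) _ _ (cderiv_id (seg a b t))) as H. rewrite Cmult_1_r in H. exact H.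
Qed.

(** The primitive is the integral from a base point. By Goursat its increment from [z] to [y] is the
    integral over that short segment, where [f] is within [eps] of [f z]. *)
Lemma holomorphic_primitive U f : Goursat_domain U -> holomorphic_on U f ->
  exists F, forall z, U z -> cderiv F z (f z).
Proof.
intros (HO & HC & HN) Hf.
destruct (classic (exists a, U a)) as [[a Ha]|Hempty].
2: { exists f. intros z Hz. destruct Hempty. exists z; exact Hz. }
assert (Hcs : forall x y, U x -> U y -> cont_on_seg f x y).
{ intros x y Hx Hy. exact (holomorphic_cont_on_seg U f x y HC Hf Hx Hy). }
exists (fun z => seg_integral f a z). intros z Hz. apply cderiv_iff. intros eps Heps.
destruct (Hf z Hz) as [l Hl]. apply cderiv_continuous in Hl.
destruct (proj1 (continuous_C_iff f z) Hl eps Heps) as [d1 [Hd1 H1]].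
destruct (HO z Hz) as [d2 [Hd2 H2]].
exists (Rmin d1 d2). split; [apply Rmin_case; assumption|]. intros y Hy.
assert (Hy1 := Rlt_le_trans _ _ _ Hy (Rmin_l _ _)).
assert (Hy2 := Rlt_le_trans _ _ _ Hy (Rmin_r _ _)).
specialize (H2 y Hy2).
destruct (HN a z y Ha Hz H2) as (V & HVc & HV & Va & Vz & Vy & HVU).
assert (HfV : holomorphic_on V f) by (intros w Hw; apply Hf, HVU, Hw).
assert (HG := Goursat V f a z y HV HVc HfV Va Vz Vy). simpl in HG.
rewrite (seg_integral_rev f a y) in HG by auto.
assert (E : seg_integral f a y - seg_integral f a z = seg_integral f z y).
{ replace (seg_integral f z y) with (seg_integral f a z + seg_integral f z y + - seg_integral f a y
   + (seg_integral f a y - seg_integral f a z)) by ring. rewrite HG. ring. }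
rewrite E.
assert (Hc : cont_on_seg (fun w => - f z) z y) by (intros t _; apply continuous_const).
replace (seg_integral f z y - (y - z) * f z) with (seg_integral (fun w => f w + - f z) z y).
- apply seg_integral_le.
  + intros t Ht. apply continuous_Cplus; [apply Hcs; assumption|apply continuous_const].
  + intros t Ht. apply Rlt_le. apply H1. eapply Rle_lt_trans; [apply seg_near, Ht|exact Hy1].
- rewrite (seg_integral_plus f (fun _ => - f z)) by auto.
  rewrite seg_integral_const. ring.
Qed.

Lemma Cmod_sym x y : Cmod (x - y) = Cmod (y - x).
Proof. rewrite <- Cmod_opp. f_equal. ring. Qed.

Lemma seg_in_ball (p x y : C) (d t : R) : (0 <= t <= 1)%R ->
  (Cmod (x - p) < d)%R -> (Cmod (y - p) < d)%R -> (Cmod (seg x y t - p) < d)%R.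
Proof.
intros Ht Hx Hy.
apply Rle_lt_trans with (Rmax (Cmod (x - p)) (Cmod (y - p))); [|apply Rmax_case; assumption].
apply seg_near_corner; [exact Ht|apply Rmax_l|apply Rmax_r].
Qed.

(** [Q] is a primitive only away from [p], so the fundamental theorem is applied on [[ep, 1]] and
    the remaining piece is bounded by its length. *)
Lemma seg_integral_tail (Q q : C -> C) (p y : C) (ep M : R) :
  (0 < ep < 1)%R -> cont_on_seg q p y ->
  (forall t, (0 < t <= 1)%R -> cderiv Q (seg p y t) (q (seg p y t))) ->
  (forall t, (0 <= t <= ep)%R -> (Cmod (q (seg p y t)) <= M)%R) ->
  (Cmod (seg_integral q p y - (Q y - Q (seg p y ep))) <= ep * (Cmod (y - p) * M))%R.
Proof.
intros Hep Hc HQ HM.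
set (g := fun t => (y - p) * q (seg p y t)).
assert (H1 : is_RInt (V := C_R_NormedModule) g 0 1 (seg_integral q p y)) by (apply seg_integral_correct, Hc).
assert (H2 : is_RInt (V := C_R_NormedModule) g ep 1 (Q y - Q (seg p y ep))).
{ replace (Q y - Q (seg p y ep)) with (minus (Q (seg p y 1)) (Q (seg p y ep))) by (rewrite seg_1; reflexivity).
  apply (is_RInt_derive (V := C_R_CompleteNormedModule) (fun t => Q (seg p y t)));
    intros t Ht; rewrite Rmin_left, Rmax_right in Ht by lra.
  - apply cderiv_comp_curve; [apply HQ; lra|apply rderiv_seg].
  - apply continuous_on_seg, Hc; lra. }
assert (H3 : is_RInt (V := C_R_NormedModule) g 0 ep (minus (seg_integral q p y) (Q y - Q (seg p y ep)))).
{ apply (is_RInt_Chasles (V := C_R_NormedModule)) with 1%R; [exact H1|].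
  apply (is_RInt_swap (V := C_R_NormedModule)), H2. }
rewrite Cmod_norm. replace (ep * (Cmod (y - p) * M))%R with ((ep - 0) * (Cmod (y - p) * M))%R by ring.
apply (norm_RInt_le_const (V := C_R_NormedModule) g 0 ep); [lra| |exact H3].
intros t Ht. unfold g. rewrite norm_C_R, Cmod_mult.
apply Rmult_le_compat_l; [apply Cmod_ge_0|apply HM, Ht].
Qed.

Lemma punctured_primitive U q p : Goursat_domain U -> U p -> cont_at q p ->
  holomorphic_on (fun z => U z /\ z <> p) q ->
  forall x, U x -> x <> p -> cderiv (fun z => seg_integral q p z) x (q x).
Proof.
intros HU Hp Hqp Hq x Hx Hxp.
(* The half-plane with [p] on its boundary line and inner normal [x - p]. It omits [p], yet contains
   the segment from [p] to any of its points, up to the end [p]. *)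
set (H := fun z => (0 < Re (Cconj (x - p) * z + - (Cconj (x - p) * p)))%R).
set (W := fun z => U z /\ H z).
assert (HW : Goursat_domain W) by (apply Goursat_domain_inter; [exact HU|apply Goursat_domain_half_plane]).
assert (Hp0 : Re (Cconj (x - p) * p + - (Cconj (x - p) * p)) = 0%R).
{ replace (Cconj (x - p) * p + - (Cconj (x - p) * p)) with (RtoC 0) by ring. reflexivity. }
assert (HWp : forall z, W z -> U z /\ z <> p).
{ intros z [Hz1 Hz2]. split; [exact Hz1|]. intros ->. unfold H in Hz2. rewrite Hp0 in Hz2. lra. }
assert (HqW : holomorphic_on W q) by (intros z Hz; apply Hq, HWp, Hz).
assert (HWx : W x).
{ split; [exact Hx|]. unfold H.
  replace (Cconj (x - p) * x + - (Cconj (x - p) * p)) with ((x - p) * Cconj (x - p)) by ring.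
  rewrite <- Cmod2_conj. apply Cminus_eq_contra, Cmod_gt_0 in Hxp.
  change (0 < Cmod (x - p) ^ 2)%R. apply pow_lt, Hxp. }
assert (HWseg : forall y t, W y -> (0 < t <= 1)%R -> W (seg p y t)).
{ intros y t [Hy1 Hy2] Ht. split.
  - apply HU; [exact Hp|exact Hy1|lra].
  - unfold H in *. rewrite Re_linear_seg, Hp0. nra. }
destruct (holomorphic_primitive W q HW HqW) as [Q HQ].
destruct (proj1 (continuous_C_iff q p) Hqp 1%R Rlt_0_1) as [d [Hd Hd1]].
set (M := (Cmod (q p) + 1)%R).
assert (HM0 : (0 < M)%R) by (unfold M; pose proof (Cmod_ge_0 (q p)); lra).
assert (HM : forall z, (Cmod (z - p) < d)%R -> (Cmod (q z) <= M)%R).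
{ intros z Hz. specialize (Hd1 z Hz). replace (q z) with ((q z - q p) + q p) by ring.
  eapply Rle_trans; [apply Cmod_triangle|]. unfold M. lra. }
assert (Hcs : forall y, W y -> cont_on_seg q p y).
{ intros y Hy t Ht. destruct (Req_dec t 0) as [->|Ht0].
  - rewrite seg_0. exact Hqp.
  - destruct (HqW (seg p y t)) as [l Hl]; [apply HWseg; [exact Hy|lra]|].
    exact (cderiv_continuous _ _ _ Hl). }
set (D := fun y => seg_integral q p y - Q y).
(* The segments from [p] to [x] and to [y] are cut at parameter [ep]. Both pieces next to [p] are of
   order [ep], and so is the difference of [Q] between the cuts, being the integral of a bounded [q]
   over a length [ep * Cmod (y - x)]. Letting [ep] tend to [0] gives equality. *)
assert (Hconst : forall y, W y -> D y = D x).
{ intros y Hy. apply Ceq_minus, Cmod_eq_0, Rle_antisym; [|apply Cmod_ge_0].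
  set (K := (Cmod (y - p) + Cmod (x - p) + Cmod (y - x))%R).
  assert (HK : (0 <= K)%R).
  { unfold K. pose proof (Cmod_ge_0 (y - p)). pose proof (Cmod_ge_0 (x - p)). pose proof (Cmod_ge_0 (y - x)). lra. }
  assert (Hsmall : forall ep, (0 < ep < 1)%R -> (ep * K < d)%R -> (Cmod (D y - D x) <= ep * (K * M))%R).
  { intros ep Hep HepK.
    assert (Hball : forall v t, (v = x \/ v = y) -> (0 <= t <= ep)%R -> (Cmod (seg p v t - p) < d)%R).
    { intros v t Hv Ht. replace (seg p v t - p) with (RtoC t * (v - p)) by (unfold seg; ring).
      rewrite Cmod_mult, Cmod_R, Rabs_pos_eq by lra.
      assert (Hv' : (Cmod (v - p) <= K)%R).
      { unfold K. pose proof (Cmod_ge_0 (y - p)). pose proof (Cmod_ge_0 (x - p)). pose proof (Cmod_ge_0 (y - x)).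
        destruct Hv as [-> | ->]; lra. }
      pose proof (Cmod_ge_0 (v - p)). nra. }
    assert (Hx1 : (Cmod (seg_integral q p x - (Q x - Q (seg p x ep))) <= ep * (Cmod (x - p) * M))%R).
    { apply seg_integral_tail; [exact Hep|apply Hcs, HWx| |].
      - intros t Ht. apply HQ, HWseg; assumption.
      - intros t Ht. apply HM, Hball; auto. }
    assert (Hy1 : (Cmod (seg_integral q p y - (Q y - Q (seg p y ep))) <= ep * (Cmod (y - p) * M))%R).
    { apply seg_integral_tail; [exact Hep|apply Hcs, Hy| |].
      - intros t Ht. apply HQ, HWseg; assumption.
      - intros t Ht. apply HM, Hball; auto. }
    assert (Hxe : W (seg p x ep)) by (apply HWseg; [exact HWx|lra]).
    assert (Hye : W (seg p y ep)) by (apply HWseg; [exact Hy|lra]).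
    assert (Hxy : (Cmod (Q (seg p y ep) - Q (seg p x ep)) <= M * (ep * Cmod (y - x)))%R).
    { assert (HCW : Cconvex W) by apply HW.
      assert (Hc2 : cont_on_seg q (seg p x ep) (seg p y ep)) by exact (holomorphic_cont_on_seg W q _ _ HCW HqW Hxe Hye).
      rewrite <- (seg_integral_primitive Q q).
      - replace (ep * Cmod (y - x))%R with (Cmod (seg p y ep - seg p x ep)).
        + apply seg_integral_le; [exact Hc2|]. intros t Ht. apply HM. apply seg_in_ball; [exact Ht| |]; apply Hball; auto; lra.
        + replace (seg p y ep - seg p x ep) with (RtoC ep * (y - x)) by (unfold seg; ring).
          rewrite Cmod_mult, Cmod_R, Rabs_pos_eq by lra. reflexivity.
      - exact Hc2.
      - intros t Ht. apply HQ. apply HCW; assumption. }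
    unfold D.
    replace (seg_integral q p y - Q y - (seg_integral q p x - Q x)) with
     ((seg_integral q p y - (Q y - Q (seg p y ep))) + - (seg_integral q p x - (Q x - Q (seg p x ep))) +
      - (Q (seg p y ep) - Q (seg p x ep))) by ring.
    eapply Rle_trans; [apply Cmod_triangle|]. rewrite Cmod_opp.
    match goal with |- (Cmod (?u + - ?v) + _ <= _)%R => pose proof (Cmod_triangle u (- v)) as HT; rewrite Cmod_opp in HT end.
    replace (ep * (K * M))%R with (ep * (Cmod (y - p) * M) + ep * (Cmod (x - p) * M) + M * (ep * Cmod (y - x)))%R
      by (unfold K; ring). lra. }
  apply Rnot_lt_le. intros Hlt. set (N := Cmod (D y - D x)) in *.
  assert (HKM : (0 <= K * M)%R) by (apply Rmult_le_pos; lra).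
  set (ep := Rmin (1 / 2) (Rmin (d / (2 * (K + 1))) (N / (2 * (K * M + 1))))).
  assert (E1 : (ep <= 1 / 2)%R) by apply Rmin_l.
  assert (E2 : (ep <= d / (2 * (K + 1)))%R) by (eapply Rle_trans; [apply Rmin_r|apply Rmin_l]).
  assert (E3 : (ep <= N / (2 * (K * M + 1)))%R) by (eapply Rle_trans; [apply Rmin_r|apply Rmin_r]).
  assert (E0 : (0 < ep)%R).
  { unfold ep. repeat apply Rmin_case; [lra| |]; apply Rdiv_lt_0_compat; lra. }
  apply Rle_div_r in E2; [|lra]. apply Rle_div_r in E3; [|lra].
  specialize (Hsmall ep ltac:(lra) ltac:(nra)). nra. }
destruct (proj1 HW x HWx) as [d' [Hd' Hd'1]].
apply (cderiv_ext_loc (fun z => Q z + D x) _ x _ d' Hd').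
- intros y Hy. rewrite <- (Hconst y (Hd'1 y Hy)). unfold D. ring.
- replace (q x) with (q x + 0) by ring. apply cderiv_plus; [apply HQ, HWx|apply cderiv_const].
Qed.

(** * Cauchy's formula *)

Lemma rderiv_RtoC (g : R -> R) (t l : R) : is_derive g t l -> rderiv (fun s => RtoC (g s)) t (RtoC l).
Proof.
intros [_ H]. apply rderiv_iff. intros eps Heps.
destruct (H t (fun P H => H) (mkposreal eps Heps)) as [d Hd].
exists d; split; [apply cond_pos|]. intros s Hs. specialize (Hd s Hs).
rewrite <- RtoC_mult, <- !RtoC_minus, Cmod_R. exact Hd.
Qed.

Lemma rderiv_plus (f g : R -> C) (x : R) (l m : C) :
  rderiv f x l -> rderiv g x m -> rderiv (fun s => f s + g s) x (l + m).
Proof. exact (is_derive_plus (K := R_AbsRing) (V := C_R_NormedModule) f g x l m). Qed.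

Lemma rderiv_scal (c : C) (g : R -> C) (t : R) (l : C) : rderiv g t l -> rderiv (fun s => c * g s) t (c * l).
Proof.
intros H. rewrite (Cmult_comm c l).
apply (cderiv_comp_curve (fun z => c * z)); [|exact H].
pose proof (cderiv_scal c (fun w => w) _ _ (cderiv_id (g t))) as H'. rewrite Cmult_1_r in H'. exact H'.
Qed.

Definition circle (c : C) (r t : R) : C := c + (RtoC (r * cos t) + Ci * RtoC (r * sin t)).

Lemma rderiv_circle c r t : rderiv (circle c r) t (Ci * (circle c r t - c)).
Proof.
replace (Ci * (circle c r t - c)) with (0 + (RtoC (r * - sin t) + Ci * RtoC (r * cos t))).
- apply (rderiv_plus (fun _ => c)); [|].
  + exact (is_derive_const (K := R_AbsRing) (V := C_R_NormedModule) c t).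
  + apply rderiv_plus; [|].
    * apply rderiv_RtoC. auto_derive; [exact I|ring].
    * apply rderiv_scal, rderiv_RtoC. auto_derive; [exact I|ring].
- unfold circle. rewrite !RtoC_mult, RtoC_opp.
  replace (Ci * (c + (r * cos t + Ci * (r * sin t)) - c)) with (Ci * (r * cos t) + (Ci * Ci) * (r * sin t)) by ring.
  replace (Ci * Ci) with (- (1)); [ring|]. unfold Ci, RtoC, Cmult, Copp; simpl; f_equal; ring.
Qed.

Lemma circle_closed c r : circle c r (2 * PI) = circle c r 0.
Proof. unfold circle. rewrite cos_2PI, sin_2PI, cos_0, sin_0. reflexivity. Qed.

Lemma Cmod_circle c r t : (0 <= r)%R -> Cmod (circle c r t - c) = r.
Proof.
intros Hr. unfold circle.
replace (c + (RtoC (r * cos t) + Ci * RtoC (r * sin t)) - c) with (RtoC (r * cos t) + Ci * RtoC (r * sin t)) by ring.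
apply Rsqr_inj; [apply Cmod_ge_0|exact Hr|].
rewrite !Rsqr_pow2, Cmod2_alt. rewrite re_plus, im_plus, re_mult, im_mult, !re_RtoC, !im_RtoC.
unfold Ci; simpl. pose proof (sin2_cos2 t) as H. unfold Rsqr in H. nra.
Qed.

(** On the circle [dw = i * (w - c) dt], so this is the contour integral of [f] divided by [i], and
    it vanishes because the curve closes up. The same normalisation gives [2 * PI] in place of
    [2 * PI * i] in Cauchy's formula. *)
Lemma circle_integral_derivative (F f : C -> C) c r :
  (forall t, cderiv F (circle c r t) (f (circle c r t))) ->
  (forall t, cont_at f (circle c r t)) ->
  is_RInt (V := C_R_NormedModule) (fun t => f (circle c r t) * (circle c r t - c)) 0 (2 * PI) (RtoC 0).
Proof.
intros HF Hf.
set (G := fun t => - Ci * F (circle c r t)).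
replace (RtoC 0) with (minus (G (2 * PI)%R) (G 0%R)).
- apply (is_RInt_derive (V := C_R_CompleteNormedModule)); intros t _.
  + unfold G. replace (f (circle c r t) * (circle c r t - c)) with (- Ci * ((Ci * (circle c r t - c)) * f (circle c r t))).
    * apply rderiv_scal. apply cderiv_comp_curve; [apply HF|apply rderiv_circle].
    * transitivity ((- Ci * Ci) * (f (circle c r t) * (circle c r t - c))); [ring|].
      replace (- Ci * Ci) with (RtoC 1); [ring|].
      unfold Ci, RtoC, Cmult, Copp; simpl; f_equal; ring.
  + pose proof (rderiv_continuous _ _ _ (rderiv_circle c r t)) as Hcirc.
    apply continuous_Cmult.
    * apply (continuous_comp (V := C_UniformSpace) (W := C_UniformSpace) (circle c r) f); [exact Hcirc|apply Hf].
    * apply continuous_Cminus; [exact Hcirc|apply continuous_const].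
- unfold G. rewrite circle_closed. apply (plus_opp_r (G := C_AbelianGroup)).
Qed.

(** The integrand is [1 + (z - c) / (w - z)]. The second term corresponds to the logarithmic
    derivative of [(w - z) / (w - c) = 1 - (z - c) / (w - c)], which stays in the right half-plane
    since [Cmod (z - c) < r]. There [L], a primitive of [1 / u], serves as a logarithm, so only the
    [1] contributes. *)
Lemma winding_number c r z : (Cmod (z - c) < r)%R ->
  is_RInt (V := C_R_NormedModule) (fun t => (circle c r t - c) / (circle c r t - z)) 0 (2 * PI) (RtoC (2 * PI)).
Proof.
intros Hz. assert (Hr : (0 < r)%R) by (pose proof (Cmod_ge_0 (z - c)); lra).
set (f := fun w => (z - c) / ((w - z) * (w - c))).
assert (Hwc : forall t, circle c r t - c <> 0) by (intros t; apply Cmod_gt_0; rewrite Cmod_circle; lra).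
assert (Hwz : forall t, circle c r t - z <> 0).
{ intros t E. pose proof (Cmod_circle c r t ltac:(lra)) as H.
  replace (circle c r t - c) with ((circle c r t - z) + (z - c)) in H by ring.
  rewrite E, Cplus_0_l in H. lra. }
destruct (holomorphic_primitive (fun u => (0 < Re (1 * u + 0))%R) Cinv) as [L HL].
{ apply Goursat_domain_half_plane. }
{ intros u Hu. exists (- / (u * u)). apply cderiv_inv. intros ->.
  replace (1 * 0 + 0) with (RtoC 0) in Hu by ring. rewrite re_RtoC in Hu. lra. }
assert (Hlog : is_RInt (V := C_R_NormedModule) (fun t => f (circle c r t) * (circle c r t - c)) 0 (2 * PI) (RtoC 0)).
{ apply (circle_integral_derivative (fun w => L (1 - (z - c) * / (w - c)))).
  - intros t. set (w := circle c r t). specialize (Hwc t). specialize (Hwz t). fold w in Hwc, Hwz.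
    assert (Hu : 1 - (z - c) * / (w - c) = (w - z) / (w - c)) by (field; exact Hwc).
    replace (f w) with ((z - c) / ((w - c) * (w - c)) * / (1 - (z - c) * / (w - c))).
    2: { rewrite Hu. unfold f. field. split; assumption. }
    apply (cderiv_comp L (fun w => 1 - (z - c) * / (w - c))).
    + apply HL. rewrite Cmult_1_l, Cplus_0_r. unfold Cminus at 1. rewrite re_plus, re_opp, re_RtoC.
      pose proof (re_le_Cmod ((z - c) * / (w - c))) as Hre. apply Rabs_le_between in Hre.
      assert (Hwr : Cmod (w - c) = r) by (apply Cmod_circle; lra).
      rewrite Cmod_mult, Cmod_inv, Hwr in Hre by exact Hwc.
      assert (Cmod (z - c) * / r < 1)%R; [|lra].
      apply (Rmult_lt_reg_r r); [exact Hr|]. rewrite Rmult_assoc, Rinv_l by lra. lra.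
    + replace ((z - c) / ((w - c) * (w - c))) with (0 - (z - c) * (1 * - / ((w - c) * (w - c)))) by (field; exact Hwc).
      apply cderiv_minus; [apply cderiv_const|]. apply (cderiv_scal (z - c) (fun w => / (w - c))).
      apply (cderiv_comp Cinv (fun w => w - c)); [apply cderiv_inv, Hwc|apply cderiv_shift].
  - intros t. unfold f, cont_at. apply continuous_Cmult; [apply continuous_const|].
    apply (continuous_Cinv (fun w => (w - z) * (w - c))); [apply Cmult_neq_0; [apply Hwz|apply Hwc]|].
    apply continuous_Cmult; apply (cderiv_continuous (fun w => w - _) _ _ (cderiv_shift _ _)). }
replace (RtoC (2 * PI)) with (plus (RtoC 0) (scal (2 * PI - 0)%R (RtoC 1))).
- apply (is_RInt_ext (V := C_R_NormedModule) (fun t => plus (f (circle c r t) * (circle c r t - c)) (RtoC 1))).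
  + intros t _. Ceq. change (plus ?u ?v) with (u + v). unfold f. field. split; auto.
  + apply (is_RInt_plus (V := C_R_NormedModule)); [exact Hlog|].
    exact (is_RInt_const (V := C_R_NormedModule) 0 (2 * PI) (RtoC 1)).
- refine (eq_trans (f_equal (Cplus 0) (scal_R_Cmult (2 * PI - 0) 1)) _). rewrite Rminus_0_r. ring.
Qed.

(** The integral lives in the real module, where [c] is not a scalar; it is moved through the
    Riemann sums instead. *)
Lemma is_RInt_Cscal (f : R -> C) (a b : R) (c l : C) :
  is_RInt (V := C_R_NormedModule) f a b l ->
  is_RInt (V := C_R_NormedModule) (fun t => c * f t) a b (c * l).
Proof.
intros H P HP. apply locally_C in HP. destruct HP as [e He].
assert (HK : (0 < Cmod c + 1)%R) by (pose proof (Cmod_ge_0 c); lra).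
assert (He' : (0 < e / (Cmod c + 1))%R) by (apply Rdiv_lt_0_compat; [apply cond_pos|exact HK]).
assert (HQ : locally (T := C_UniformSpace) l (fun w => P (c * w))).
{ apply locally_C. exists (mkposreal _ He'). intros w Hw. apply He.
  change (Cmod (c * w - c * l) < e)%R. change (Cmod (w - l) < e / (Cmod c + 1))%R in Hw.
  replace (c * w - c * l) with (c * (w - l)) by ring. rewrite Cmod_mult.
  apply Rlt_div_r in Hw; [|exact HK]. pose proof (Cmod_ge_0 (w - l)). lra. }
specialize (H _ HQ). unfold filtermap in *. revert H. apply filter_imp. intros ptd Hptd.
assert (E : Riemann_sum (V := C_R_NormedModule) (fun t => c * f t) ptd = c * Riemann_sum (V := C_R_NormedModule) f ptd).
{ clear. induction ptd as [x|x0 s IH] using SF_cons_ind.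
  - unfold Riemann_sum; simpl. Ceq. change (@zero _) with (RtoC 0). ring.
  - rewrite !Riemann_sum_cons, IH. Ceq. change (plus ?u ?v) with (u + v).
    rewrite !scal_R_Cmult. ring. }
rewrite E. rewrite scal_R_Cmult in Hptd |- *.
replace (RtoC (sign (b - a)) * (c * Riemann_sum (V := C_R_NormedModule) f ptd)) with
  (c * (RtoC (sign (b - a)) * Riemann_sum (V := C_R_NormedModule) f ptd)) by ring.
exact Hptd.
Qed.

Definition diff_quot (f : C -> C) (p l z : C) : C :=
  if Ceq_dec z p then l else (f z - f p) / (z - p).

Lemma diff_quot_at f p l : diff_quot f p l p = l.
Proof. unfold diff_quot. destruct (Ceq_dec p p); congruence. Qed.

Lemma diff_quot_off f p l z : z <> p -> diff_quot f p l z = (f z - f p) / (z - p).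
Proof. intros H. unfold diff_quot. destruct (Ceq_dec z p); congruence. Qed.

Lemma diff_quot_mult f p l z : (z - p) * diff_quot f p l z = f z - f p.
Proof.
unfold diff_quot. destruct (Ceq_dec z p) as [->|H]; [ring|].
field. apply Cminus_eq_contra, H.
Qed.

Lemma diff_quot_continuous f p l : cderiv f p l -> cont_at (diff_quot f p l) p.
Proof.
intros H. apply continuous_C_iff. intros eps Heps. rewrite cderiv_iff in H.
destruct (H (eps / 2)%R ltac:(lra)) as [d [Hd H1]]. exists d; split; [exact Hd|]. intros y Hy.
rewrite diff_quot_at. destruct (Ceq_dec y p) as [->|Hyp].
- rewrite diff_quot_at. replace (l - l) with (RtoC 0) by ring. rewrite Cmod_0. exact Heps.
- specialize (H1 y Hy). rewrite <- (diff_quot_mult f p l y) in H1.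
  replace ((y - p) * diff_quot f p l y - (y - p) * l) with ((diff_quot f p l y - l) * (y - p)) in H1 by ring.
  rewrite Cmod_mult in H1. apply Rmult_le_reg_r in H1; [lra|].
  apply Cmod_gt_0, Cminus_eq_contra, Hyp.
Qed.

Lemma diff_quot_deriv_off f p l z m : z <> p -> cderiv f z m ->
  exists k, cderiv (diff_quot f p l) z k.
Proof.
intros Hz Hf. exists ((m - 0) * / (z - p) + (f z - f p) * (1 * - / ((z - p) * (z - p)))).
apply Cminus_eq_contra in Hz.
apply (cderiv_ext_loc (fun z => (f z - f p) * / (z - p)) _ z _ (Cmod (z - p))).
- apply Cmod_gt_0, Hz.
- intros y Hy. rewrite diff_quot_off; [reflexivity|]. intros ->. rewrite Cmod_sym in Hy. lra.
- apply (cderiv_mult (fun z => f z - f p) (fun z => / (z - p))).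
  + apply (cderiv_minus f (fun _ => f p)); [exact Hf|apply cderiv_const].
  + apply (cderiv_comp Cinv (fun z => z - p)); [apply cderiv_inv, Hz|apply cderiv_shift].
Qed.

Lemma Cauchy_formula U f c r z : Goursat_domain U -> holomorphic_on U f ->
  (forall w, (Cmod (w - c) <= r)%R -> U w) -> (Cmod (z - c) < r)%R ->
  is_RInt (V := C_R_NormedModule)
    (fun t => f (circle c r t) * ((circle c r t - c) / (circle c r t - z))) 0 (2 * PI) (RtoC (2 * PI) * f z).
Proof.
intros HU Hf HD Hz. assert (Hr : (0 < r)%R) by (pose proof (Cmod_ge_0 (z - c)); lra).
assert (Uz : U z) by (apply HD; lra).
destruct (Hf z Uz) as [l Hl].
set (q := diff_quot f z l).
assert (Hwz : forall t, circle c r t <> z).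
{ intros t E. pose proof (Cmod_circle c r t ltac:(lra)) as H. rewrite E in H. lra. }
assert (Uw : forall t, U (circle c r t)) by (intros t; apply HD; rewrite Cmod_circle; lra).
assert (Hq : holomorphic_on (fun w => U w /\ w <> z) q).
{ intros w [Hw Hwz']. destruct (Hf w Hw) as [m Hm]. exact (diff_quot_deriv_off f z l w m Hwz' Hm). }
assert (Hint : is_RInt (V := C_R_NormedModule) (fun t => q (circle c r t) * (circle c r t - c)) 0 (2 * PI) (RtoC 0)).
{ apply (circle_integral_derivative (fun w => seg_integral q z w)).
  - intros t. apply (punctured_primitive U); auto. apply diff_quot_continuous, Hl.
  - intros t. destruct (Hq (circle c r t)) as [k Hk]; [auto|]. exact (cderiv_continuous _ _ _ Hk). }
replace (RtoC (2 * PI) * f z) with (plus (RtoC 0) (f z * RtoC (2 * PI))).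
- apply (is_RInt_ext (V := C_R_NormedModule)
    (fun t => plus (q (circle c r t) * (circle c r t - c)) (f z * ((circle c r t - c) / (circle c r t - z))))).
  + intros t _. Ceq. change (plus ?u ?v) with (u + v). unfold q. rewrite diff_quot_off by auto. field.
    apply Cminus_eq_contra, Hwz.
  + apply (is_RInt_plus (V := C_R_NormedModule)); [exact Hint|].
    apply is_RInt_Cscal, winding_number, Hz.
- Ceq. change (plus ?u ?v) with (u + v). ring.
Qed.

(** * Difference quotients and the maximum principle *)

Lemma two_PI_neq_0 : RtoC (2 * PI) <> 0.
Proof. intros H. apply RtoC_inj in H. pose proof PI_RGT_0. lra. Qed.

Lemma circle_bound f c r : (forall t, cont_at f (circle c r t)) ->
  exists M, (0 < M)%R /\ forall t, (0 <= t <= 2 * PI)%R -> (Cmod (f (circle c r t)) <= M)%R.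
Proof.
intros Hf.
destruct (bounded_continuity (K := R_AbsRing) (V := C_R_NormedModule) (fun t => f (circle c r t)) 0 (2 * PI)) as [M HM].
- intros t _.
  apply (continuous_comp (V := C_UniformSpace) (W := C_UniformSpace) (circle c r) f); [|apply Hf].
  exact (rderiv_continuous _ _ _ (rderiv_circle c r t)).
- exists (Rmax M 1). split; [eapply Rlt_le_trans; [|apply Rmax_r]; lra|].
  intros t Ht. eapply Rle_trans; [|apply Rmax_l]. rewrite <- norm_C_R. apply Rlt_le, HM, Ht.
Qed.

(** Cauchy's kernel is expanded as a finite geometric sum: with [a = w - p] and [s = z - p], [a / (a
    - s) = 1 + s / a + s ^ 2 / a ^ 2 + s ^ 3 / (a ^ 2 * (a - s))]. The second order is what the
    derivative of a difference quotient at [p] requires. *)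
Lemma Taylor_order_2 U f p : Goursat_domain U -> holomorphic_on U f -> U p ->
  exists A B K d, (0 < d)%R /\ (0 < K)%R /\ forall z, (Cmod (z - p) < d)%R ->
    (Cmod (f z - f p - (z - p) * A - (z - p) * (z - p) * B) <= K * Cmod (z - p) ^ 3)%R.
Proof.
intros HU Hf Hp. destruct (proj1 HU p Hp) as [d0 [Hd0 Hd]].
set (r := (d0 / 2)%R). assert (Hr : (0 < r)%R) by (unfold r; lra).
assert (HD : forall w, (Cmod (w - p) <= r)%R -> U w) by (intros w Hw; apply Hd; unfold r in Hw; lra).
set (w := circle p r).
assert (Hwr : forall t, Cmod (w t - p) = r) by (intros t; apply Cmod_circle; lra).
assert (Hwp : forall t, w t - p <> 0) by (intros t; apply Cmod_gt_0; rewrite Hwr; exact Hr).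
assert (Hfc : forall t, cont_at f (w t)).
{ intros t. destruct (Hf (w t)) as [l Hl]; [apply HD; rewrite Hwr; lra|]. exact (cderiv_continuous _ _ _ Hl). }
destruct (circle_bound f p r Hfc) as [M [HM0 HM]]. fold w in HM.
assert (Hwc : forall t, continuous (U := C_UniformSpace) w t) by (intros t; exact (rderiv_continuous _ _ _ (rderiv_circle p r t))).
assert (Hfw : forall t, continuous (U := C_UniformSpace) (fun t => f (w t)) t).
{ intros t. apply (continuous_comp (V := C_UniformSpace) (W := C_UniformSpace) w f); [apply Hwc|apply Hfc]. }
assert (Hiw : forall t, continuous (U := C_UniformSpace) (fun t => / (w t - p)) t).
{ intros t. apply (continuous_Cinv (fun t => w t - p)); [apply Hwp|].
  apply continuous_Cminus; [apply Hwc|apply continuous_const]. }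
destruct (ex_RInt_continuous (V := C_R_CompleteNormedModule) (fun t => f (w t) * / (w t - p)) 0 (2 * PI)) as [A HA].
{ intros t _. apply continuous_Cmult; [apply Hfw|apply Hiw]. }
destruct (ex_RInt_continuous (V := C_R_CompleteNormedModule) (fun t => f (w t) * / (w t - p) * / (w t - p)) 0 (2 * PI)) as [B HB].
{ intros t _. apply continuous_Cmult; [|apply Hiw]. apply continuous_Cmult; [apply Hfw|apply Hiw]. }
pose proof PI_RGT_0 as HPI.
(* For [Cmod (z - p) < r / 2] the circle keeps distance at least [r / 2] from [z], which bounds the
   last factor of the remainder's denominator. *)
exists (A / RtoC (2 * PI)), (B / RtoC (2 * PI)), (M * / (r * r * (r / 2)))%R, (r / 2)%R.
split; [lra|]. split.
{ apply Rmult_lt_0_compat; [exact HM0|]. apply Rinv_0_lt_compat. repeat apply Rmult_lt_0_compat; lra. }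
intros z Hz.
assert (Hwz : forall t, (r / 2 <= Cmod (w t - z))%R).
{ intros t. pose proof (Cmod_triangle (w t - z) (z - p)) as H.
  replace (w t - z + (z - p)) with (w t - p) in H by ring. rewrite Hwr in H. lra. }
assert (Hwz0 : forall t, w t - z <> 0) by (intros t; apply Cmod_gt_0; pose proof (Hwz t); lra).
assert (Iz := Cauchy_formula U f p r z HU Hf HD ltac:(lra)).
assert (Ip := Cauchy_formula U f p r p HU Hf HD ltac:(replace (p - p) with (RtoC 0) by ring; rewrite Cmod_0; exact Hr)).
fold w in Iz, Ip.
set (E := RtoC (2 * PI) * f z - RtoC (2 * PI) * f p - (z - p) * A - (z - p) * (z - p) * B).
assert (IE : is_RInt (V := C_R_NormedModule) (fun t => f (w t) * ((z - p) * (z - p) * (z - p) * / ((w t - p) * (w t - p) * (w t - z)))) 0 (2 * PI) E).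
{ apply (is_RInt_ext (V := C_R_NormedModule) (fun t => minus (minus (minus (f (w t) * ((w t - p) / (w t - z))) (f (w t) * ((w t - p) / (w t - p)))) ((z - p) * (f (w t) * / (w t - p))))
     ((z - p) * (z - p) * (f (w t) * / (w t - p) * / (w t - p))))).
  - intros t _. Ceq. change (f (w t) * ((w t - p) / (w t - z)) - f (w t) * ((w t - p) / (w t - p)) - (z - p) * (f (w t) * / (w t - p)) -
      (z - p) * (z - p) * (f (w t) * / (w t - p) * / (w t - p)) = f (w t) * ((z - p) * (z - p) * (z - p) * / ((w t - p) * (w t - p) * (w t - z)))).
    field. split; auto.
  - apply (is_RInt_minus (V := C_R_NormedModule)); [apply (is_RInt_minus (V := C_R_NormedModule)); [apply (is_RInt_minus (V := C_R_NormedModule))|]|].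
    + exact Iz.
    + exact Ip.
    + apply is_RInt_Cscal, HA.
    + apply is_RInt_Cscal, HB. }
assert (HE : (Cmod E <= (2 * PI - 0) * (M * / (r * r * (r / 2)) * Cmod (z - p) ^ 3))%R).
{ rewrite Cmod_norm. eapply (norm_RInt_le_const (V := C_R_NormedModule)); [| |exact IE]; [lra|].
  intros t Ht. rewrite norm_C_R, !Cmod_mult, Cmod_inv by (repeat apply Cmult_neq_0; auto).
  rewrite !Cmod_mult, !Hwr.
  replace (M * / (r * r * (r / 2)) * Cmod (z - p) ^ 3)%R with
   (M * (Cmod (z - p) * Cmod (z - p) * Cmod (z - p) * / (r * r * (r / 2))))%R by ring.
  pose proof (Cmod_ge_0 (z - p)) as Hzp.
  apply Rmult_le_compat; [apply Cmod_ge_0| |apply HM, Ht|].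
  - apply Rmult_le_pos; [repeat apply Rmult_le_pos; exact Hzp|].
    apply Rlt_le, Rinv_0_lt_compat. apply Rmult_lt_0_compat; [apply Rmult_lt_0_compat; lra|].
    pose proof (Hwz t); lra.
  - apply Rmult_le_compat_l; [repeat apply Rmult_le_pos; exact Hzp|].
    apply Rinv_le_contravar; [repeat apply Rmult_lt_0_compat; lra|].
    apply Rmult_le_compat_l; [apply Rmult_le_pos; lra|apply Hwz]. }
replace (f z - f p - (z - p) * (A / RtoC (2 * PI)) - (z - p) * (z - p) * (B / RtoC (2 * PI))) with (E / RtoC (2 * PI)).
- rewrite Cmod_div by exact two_PI_neq_0. rewrite Cmod_R, Rabs_pos_eq by lra.
  apply Rle_div_l; [lra|]. lra.
- unfold E. field. exact two_PI_neq_0.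
Qed.

(** At [p], the Taylor estimate divided by [z - p] says that the quotient has derivative [B], once
    the coefficient [A] is identified with [l] by uniqueness of derivatives. *)
Lemma diff_quot_holomorphic U f p l : Goursat_domain U -> holomorphic_on U f -> U p -> cderiv f p l ->
  holomorphic_on U (diff_quot f p l).
Proof.
intros HU Hf Hp Hl z Hz. destruct (Ceq_dec z p) as [->|Hzp].
2: { destruct (Hf z Hz) as [m Hm]. exact (diff_quot_deriv_off f p l z m Hzp Hm). }
destruct (Taylor_order_2 U f p HU Hf Hp) as (A & B & K & d & Hd & HK & HT).
assert (HA : cderiv f p A).
{ apply cderiv_iff. intros eps Heps.
  set (L := (Cmod B + K)%R). assert (HL : (0 < L)%R) by (unfold L; pose proof (Cmod_ge_0 B); lra).
  exists (Rmin d (Rmin 1 (eps / L))). split.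
  { repeat apply Rmin_case; [lra|lra|apply Rdiv_lt_0_compat; lra]. }
  intros y Hy.
  assert (Hy1 := Rlt_le_trans _ _ _ Hy (Rmin_l _ _)).
  assert (Hy2 := Rlt_le_trans _ _ _ Hy (Rmin_r _ _)).
  assert (Hy3 := Rlt_le_trans _ _ _ Hy2 (Rmin_l _ _)).
  assert (Hy4 := Rlt_le_trans _ _ _ Hy2 (Rmin_r _ _)). apply Rlt_div_r in Hy4; [|exact HL].
  specialize (HT y Hy1). pose proof (Cmod_ge_0 (y - p)) as H0. set (s := Cmod (y - p)) in *.
  replace (f y - f p - (y - p) * A) with ((f y - f p - (y - p) * A - (y - p) * (y - p) * B) + (y - p) * (y - p) * B) by ring.
  eapply Rle_trans; [apply Cmod_triangle|]. rewrite (Cmod_mult _ B), Cmod_mult. fold s.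
  assert (K * s ^ 3 <= K * (s * s))%R.
  { apply Rmult_le_compat_l; [lra|]. simpl. rewrite Rmult_1_r. nra. }
  unfold L in Hy4. nra. }
pose proof (cderiv_unique f p l A Hl HA) as ->.
exists B. apply cderiv_iff. intros eps Heps.
exists (Rmin d (eps / K)). split.
{ apply Rmin_case; [lra|apply Rdiv_lt_0_compat; lra]. }
intros y Hy.
assert (Hy1 := Rlt_le_trans _ _ _ Hy (Rmin_l _ _)).
assert (Hy2 := Rlt_le_trans _ _ _ Hy (Rmin_r _ _)). apply Rlt_div_r in Hy2; [|exact HK].
specialize (HT y Hy1). rewrite diff_quot_at. destruct (Ceq_dec y p) as [->|Hyp].
{ rewrite diff_quot_at. replace (A - A - (p - p) * B) with (RtoC 0) by ring. replace (p - p) with (RtoC 0) by ring.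
  rewrite Cmod_0. lra. }
rewrite <- (diff_quot_mult f p A y) in HT.
replace ((y - p) * diff_quot f p A y - (y - p) * A - (y - p) * (y - p) * B) with
  ((diff_quot f p A y - A - (y - p) * B) * (y - p)) in HT by ring.
rewrite Cmod_mult in HT.
assert (Hs : (0 < Cmod (y - p))%R) by (apply Cmod_gt_0, Cminus_eq_contra, Hyp).
set (s := Cmod (y - p)) in *.
replace (K * s ^ 3)%R with (K * s * s * s)%R in HT by ring.
apply Rmult_le_reg_r in HT; [|exact Hs]. nra.
Qed.

Lemma holomorphic_pow U f n : holomorphic_on U f -> holomorphic_on U (fun z => f z ^ n).
Proof.
intros Hf z Hz. induction n as [|n [k Hk]].
- exists 0. exact (cderiv_const 1 z).
- destruct (Hf z Hz) as [l Hl]. eexists. exact (cderiv_mult f (fun z => f z ^ n) z _ _ Hl Hk).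
Qed.

(* Landau's trick: Cauchy's formula for [f ^ n] loses a factor independent of [n]. *)
Lemma maximum_modulus U f c r M z : Goursat_domain U -> holomorphic_on U f ->
  (forall w, (Cmod (w - c) <= r)%R -> U w) -> (Cmod (z - c) < r)%R -> (0 < M)%R ->
  (forall w, Cmod (w - c) = r -> (Cmod (f w) <= M)%R) -> (Cmod (f z) <= M)%R.
Proof.
intros HU Hf HD Hz HM Hfw. pose proof PI_RGT_0 as HPI.
assert (Hr : (0 < r)%R) by (pose proof (Cmod_ge_0 (z - c)); lra).
set (K := (r * / (r - Cmod (z - c)))%R).
assert (Hn : forall n, (Cmod (f z) ^ n <= M ^ n * K)%R).
{ intros n.
  pose proof (Cauchy_formula U (fun z => f z ^ n) c r z HU (holomorphic_pow U f n Hf) HD Hz) as HI.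
  assert (HC : (Cmod (RtoC (2 * PI) * f z ^ n) <= (2 * PI - 0) * (M ^ n * K))%R).
  { rewrite Cmod_norm. eapply (norm_RInt_le_const (V := C_R_NormedModule)); [| |exact HI]; [lra|].
    intros t _. rewrite norm_C_R. set (w := circle c r t).
    assert (Hw : Cmod (w - c) = r) by (apply Cmod_circle; lra).
    assert (Hwz : (r - Cmod (z - c) <= Cmod (w - z))%R).
    { pose proof (Cmod_triangle (w - z) (z - c)) as H.
      replace (w - z + (z - c)) with (w - c) in H by ring. lra. }
    rewrite Cmod_mult, Cmod_pow, (Cmod_div (w - c) (w - z)) by (apply Cmod_gt_0; lra). rewrite Hw.
    apply Rmult_le_compat.
    - apply pow_le, Cmod_ge_0.
    - apply Rdiv_le_0_compat; lra.
    - apply pow_incr. split; [apply Cmod_ge_0|apply Hfw, Hw].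
    - apply Rmult_le_compat_l; [lra|]. apply Rinv_le_contravar; lra. }
  rewrite Cmod_mult, Cmod_R, Rabs_pos_eq, Cmod_pow, Rminus_0_r in HC by lra.
  apply Rmult_le_reg_l in HC; [exact HC|lra]. }
apply Rnot_lt_le. intros Hlt.
assert (Hx : (1 < Cmod (f z) / M)%R) by (apply Rlt_div_r; lra).
destruct (Pow_x_infinity (Cmod (f z) / M) ltac:(rewrite Rabs_pos_eq; lra) (K + 1)) as [n Hn'].
specialize (Hn' n (Nat.le_refl n)). rewrite Rabs_pos_eq in Hn' by (apply pow_le; lra).
specialize (Hn n). unfold Rdiv in Hn'. rewrite Rpow_mult_distr, pow_inv in Hn'.
assert (HMn : (0 < M ^ n)%R) by (apply pow_lt; exact HM).
assert (Cmod (f z) ^ n * / M ^ n <= K)%R; [|lra].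
apply (Rmult_le_reg_r (M ^ n)); [exact HMn|]. rewrite Rmult_assoc, Rinv_l by lra. lra.
Qed.

(** * The Schwarz-Pick inequality *)

Lemma Goursat_domain_rhp : Goursat_domain right_half_plane.
Proof.
replace right_half_plane with (fun z => (0 < Re (1 * z + 0))%R); [apply Goursat_domain_half_plane|].
apply functional_extensionality. intros z. apply propositional_extensionality.
rewrite Cmult_1_l, Cplus_0_r. reflexivity.
Qed.

Lemma Cmod2_coords z : (Cmod z * Cmod z = Re z * Re z + Im z * Im z)%R.
Proof. pose proof (Cmod2_alt z). lra. Qed.

Lemma Cmod2_minus z w : (Cmod (z - w) * Cmod (z - w) =
  (Re z - Re w) * (Re z - Re w) + (Im z - Im w) * (Im z - Im w))%R.
Proof. rewrite Cmod2_coords. reflexivity. Qed.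

Lemma Cmod2_plus_conj z w : (Cmod (z + Cconj w) * Cmod (z + Cconj w) =
  (Re z + Re w) * (Re z + Re w) + (Im z - Im w) * (Im z - Im w))%R.
Proof. rewrite Cmod2_coords. reflexivity. Qed.

Lemma Cmod_sqr_le z w : (Cmod z * Cmod z <= Cmod w * Cmod w)%R -> (Cmod z <= Cmod w)%R.
Proof. intros H. pose proof (Cmod_ge_0 z). pose proof (Cmod_ge_0 w). nra. Qed.

Lemma plus_conj_neq_0 z w : (0 < Re z)%R -> (0 < Re w)%R -> z + Cconj w <> 0.
Proof.
intros Hz Hw E. apply (f_equal Re) in E. rewrite re_plus, re_conj, re_RtoC in E. lra.
Qed.

Lemma Cmod_minus_le_plus_conj z w : (0 < Re z)%R -> (0 < Re w)%R ->
  (Cmod (z - w) <= Cmod (z + Cconj w))%R.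
Proof.
intros Hz Hw. apply Cmod_sqr_le. rewrite Cmod2_minus, Cmod2_plus_conj. nra.
Qed.

Lemma Cmod_minus_lt_plus_conj z w : (0 < Re z)%R -> (0 < Re w)%R ->
  (Cmod (z - w) < Cmod (z + Cconj w))%R.
Proof.
intros Hz Hw. apply Rnot_le_lt. intros H.
assert (H2 : (Cmod (z + Cconj w) * Cmod (z + Cconj w) <= Cmod (z - w) * Cmod (z - w))%R).
{ apply Rmult_le_compat; try exact H; apply Cmod_ge_0. }
rewrite Cmod2_minus, Cmod2_plus_conj in H2. nra.
Qed.

(** Centre of the circle [Cmod (w - zeta) = rho * Cmod (w + conj zeta)], found by completing the
    square; it is a hyperbolic circle around [zeta]. *)
Definition Apollonius_center (zeta : C) (rho : R) : C :=
  (Re zeta * (1 + rho * rho) / (1 - rho * rho), Im zeta)%R.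

Definition Apollonius_radius (zeta : C) (rho : R) : R :=
  (2 * Re zeta * rho / (1 - rho * rho))%R.

(** An identity, so that it serves both for points on the circle and for the position of a point
    relative to it. *)
Lemma Apollonius_circle (zeta w : C) (rho : R) : (0 < rho < 1)%R ->
  (Cmod (w - zeta) * Cmod (w - zeta) - rho * rho * (Cmod (w + Cconj zeta) * Cmod (w + Cconj zeta)) =
   (1 - rho * rho) * (Cmod (w - Apollonius_center zeta rho) * Cmod (w - Apollonius_center zeta rho) -
      Apollonius_radius zeta rho * Apollonius_radius zeta rho))%R.
Proof.
intros Hr. rewrite !Cmod2_minus, Cmod2_plus_conj. unfold Apollonius_center, Apollonius_radius.
simpl (Re (_, _)). simpl (Im (_, _)). unfold Re, Im. simpl. field. nra.
Qed.

(** The leftmost point of the disc has real part [Re zeta * (1 - rho) / (1 + rho)]. *)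
Lemma Apollonius_disc_rhp (zeta w : C) (rho : R) : (0 < rho < 1)%R -> (0 < Re zeta)%R ->
  (Cmod (w - Apollonius_center zeta rho) <= Apollonius_radius zeta rho)%R -> (0 < Re w)%R.
Proof.
intros Hr Hz Hw.
pose proof (re_le_Cmod (w - Apollonius_center zeta rho)) as H. apply Rabs_le_between in H.
change (Re (w - ?c)) with (Re w - Re c)%R in H.
assert (Hc : (Re (Apollonius_center zeta rho) - Apollonius_radius zeta rho = Re zeta * ((1 - rho) / (1 + rho)))%R).
{ unfold Apollonius_center, Apollonius_radius. simpl. field. split; nra. }
assert (0 < Re zeta * ((1 - rho) / (1 + rho)))%R.
{ apply Rmult_lt_0_compat; [exact Hz|]. apply Rdiv_lt_0_compat; lra. }
lra.
Qed.

(* The bound [1 / rho] on the Apollonius circle of ratio [rho] tends to [1] as the circles exhaust the half-plane. *)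
Lemma Schwarz_Pick_strict h xi zeta : holomorphic_on right_half_plane h ->
  (forall z, right_half_plane z -> (0 < Re (h z))%R) ->
  right_half_plane xi -> right_half_plane zeta -> xi <> zeta ->
  (Cmod (h xi - h zeta) * Cmod (xi + Cconj zeta) <= Cmod (h xi + Cconj (h zeta)) * Cmod (xi - zeta))%R.
Proof.
intros Hh Hpos Hxi Hzeta Hne. unfold right_half_plane in Hxi, Hzeta.
destruct (Hh zeta Hzeta) as [l Hl].
(* The quotient of the Cayley transforms of [h] and of [w], with the singularity at [zeta] removed.
   The claim is [Cmod (q xi) <= 1]. *)
set (q := fun w => diff_quot h zeta l w * ((w + Cconj zeta) * / (h w + Cconj (h zeta)))).
assert (Hden : forall w, right_half_plane w -> h w + Cconj (h zeta) <> 0).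
{ intros w Hw. apply plus_conj_neq_0; apply Hpos; assumption. }
assert (Hq : holomorphic_on right_half_plane q).
{ intros w Hw.
  destruct (diff_quot_holomorphic _ h zeta l Goursat_domain_rhp Hh Hzeta Hl w Hw) as [m Hm].
  destruct (Hh w Hw) as [k Hk].
  pose proof (cderiv_plus _ _ w _ _ (cderiv_id w) (cderiv_const (Cconj zeta) w)) as H1.
  pose proof (cderiv_plus _ _ w _ _ Hk (cderiv_const (Cconj (h zeta)) w)) as H2.
  pose proof (cderiv_comp Cinv _ w _ _ (cderiv_inv _ (Hden w Hw)) H2) as H3.
  eexists. exact (cderiv_mult _ _ w _ _ Hm (cderiv_mult _ _ w _ _ H1 H3)). }
assert (Hqmod : forall w, right_half_plane w -> w <> zeta ->
  Cmod (q w) = (Cmod (h w - h zeta) * Cmod (w + Cconj zeta) / (Cmod (w - zeta) * Cmod (h w + Cconj (h zeta))))%R).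
{ intros w Hw Hwz. unfold q. rewrite diff_quot_off by exact Hwz.
  assert (Hwz' : w - zeta <> 0) by (apply Cminus_eq_contra, Hwz).
  rewrite !Cmod_mult, Cmod_div, Cmod_inv by auto.
  field. split; apply Rgt_not_eq, Cmod_gt_0; auto. }
assert (Hxz : (0 < Cmod (xi - zeta))%R) by (apply Cmod_gt_0, Cminus_eq_contra, Hne).
pose proof (Cmod_minus_lt_plus_conj xi zeta Hxi Hzeta) as Hlt.
assert (Hxz' : (0 < Cmod (xi + Cconj zeta))%R) by lra.
set (ratio := (Cmod (xi - zeta) / Cmod (xi + Cconj zeta))%R).
assert (Hratio : (0 < ratio < 1)%R).
{ unfold ratio. split; [apply Rdiv_lt_0_compat; assumption|]. apply Rlt_div_l; lra. }
assert (Hrho : forall rho, (ratio < rho < 1)%R -> (rho * Cmod (q xi) <= 1)%R).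
{ intros rho Hrho. assert (Hrho1 : (0 < rho < 1)%R) by lra.
  assert (Hrr : (0 < 1 - rho * rho)%R) by nra.
  set (c := Apollonius_center zeta rho). set (r := Apollonius_radius zeta rho).
  assert (Hr : (0 < r)%R).
  { unfold r, Apollonius_radius. apply Rdiv_lt_0_compat; [|exact Hrr]. repeat apply Rmult_lt_0_compat; lra. }
  assert (HM : (Cmod (q xi) <= / rho)%R).
  { apply (maximum_modulus right_half_plane q c r); [apply Goursat_domain_rhp|exact Hq| | | |].
    - intros w Hw. apply (Apollonius_disc_rhp zeta w rho); assumption.
    - pose proof (Apollonius_circle zeta xi rho Hrho1) as HA. fold c r in HA.
      assert (Hlt2 : (Cmod (xi - zeta) < rho * Cmod (xi + Cconj zeta))%R).
      { destruct Hrho as [Hrho _]. unfold ratio in Hrho. apply Rlt_div_l in Hrho; [lra|exact Hxz']. }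
      apply Rnot_le_lt. intros Hge.
      assert (H1 : (r * r <= Cmod (xi - c) * Cmod (xi - c))%R) by (apply Rmult_le_compat; lra).
      assert (H2 : (Cmod (xi - zeta) * Cmod (xi - zeta) <
        rho * Cmod (xi + Cconj zeta) * (rho * Cmod (xi + Cconj zeta)))%R).
      { apply Rmult_le_0_lt_compat; lra. }
      assert (H3 : (0 <= (1 - rho * rho) * (Cmod (xi - c) * Cmod (xi - c) - r * r))%R) by (apply Rmult_le_pos; lra).
      lra.
    - apply Rinv_0_lt_compat; lra.
    (* On the circle the Cayley transform of [w] has modulus exactly [rho], and that of [h w] has
       modulus at most [1] because [h w] lies in the right half-plane. *)
    - intros w Hw. assert (Hwr : right_half_plane w).
      { apply (Apollonius_disc_rhp zeta w rho); [lra|exact Hzeta|]. fold c r. lra. }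
      pose proof (Apollonius_circle zeta w rho Hrho1) as HA. fold c r in HA. rewrite Hw in HA.
      assert (Hw1 : (0 < Cmod (w + Cconj zeta))%R) by (apply Cmod_gt_0, plus_conj_neq_0; assumption).
      assert (Hw2 : (Cmod (w - zeta) = rho * Cmod (w + Cconj zeta))%R).
      { apply Rsqr_inj; [apply Cmod_ge_0|apply Rmult_le_pos; lra|]. unfold Rsqr. lra. }
      assert (Hwz : w <> zeta).
      { intros ->. replace (zeta - zeta) with (RtoC 0) in Hw2 by ring. rewrite Cmod_0 in Hw2. nra. }
      rewrite Hqmod, Hw2 by assumption.
      assert (Hd : (0 < Cmod (h w + Cconj (h zeta)))%R) by (apply Cmod_gt_0, Hden, Hwr).
      pose proof (Cmod_minus_le_plus_conj (h w) (h zeta) (Hpos w Hwr) (Hpos zeta Hzeta)) as Hle.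
      apply Rle_div_l; [repeat apply Rmult_lt_0_compat; lra|].
      replace (/ rho * (rho * Cmod (w + Cconj zeta) * Cmod (h w + Cconj (h zeta))))%R with
       (Cmod (h w + Cconj (h zeta)) * Cmod (w + Cconj zeta))%R by (field; lra).
      apply Rmult_le_compat_r; [lra|exact Hle]. }
  apply Rmult_le_compat_l with (r := rho) in HM; [|lra]. rewrite Rinv_r in HM by lra. exact HM. }
assert (Hq1 : (Cmod (q xi) <= 1)%R).
{ apply Rnot_lt_le. intros Hgt. set (Q := Cmod (q xi)) in *.
  assert (HQ : (0 < / Q < 1)%R).
  { split; [apply Rinv_0_lt_compat; lra|]. rewrite <- Rinv_1. apply Rinv_lt_contravar; lra. }
  (* Any [rho < 1] above both [ratio] and [/ Q] contradicts [rho * Q <= 1]; midpoints to [1] provide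
     one. *)
  set (rho := Rmax ((ratio + 1) / 2) ((/ Q + 1) / 2)).
  assert (H1 : ((ratio + 1) / 2 <= rho)%R) by apply Rmax_l.
  assert (H2 : ((/ Q + 1) / 2 <= rho)%R) by apply Rmax_r.
  assert (H3 : (rho < 1)%R) by (unfold rho; apply Rmax_case; lra).
  specialize (Hrho rho ltac:(lra)).
  assert (H4 : ((/ Q + 1) / 2 * Q <= 1)%R) by nra.
  replace ((/ Q + 1) / 2 * Q)%R with ((1 + Q) / 2)%R in H4 by (field; lra). lra. }
rewrite Hqmod in Hq1 by assumption.
assert (Hd : (0 < Cmod (h xi + Cconj (h zeta)))%R) by (apply Cmod_gt_0, Hden, Hxi).
apply Rle_div_l in Hq1; [|apply Rmult_lt_0_compat; assumption]. lra.
Qed.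

(** Nonnegativity of the determinant of the Pick matrix, with denominators cleared. The strict
    version applies to [h + eps], whose real part is positive, and [eps] then tends to [0]. As
    [eps < 1], the error in the product of real parts is at most [eps * (U + V + 1)]. *)
Lemma Schwarz_Pick h xi zeta : holomorphic_on right_half_plane h ->
  (forall z, right_half_plane z -> (0 <= Re (h z))%R) ->
  right_half_plane xi -> right_half_plane zeta ->
  (Cmod (h xi + Cconj (h zeta)) * Cmod (h xi + Cconj (h zeta)) * (Re xi * Re zeta) <=
   Re (h xi) * Re (h zeta) * (Cmod (xi + Cconj zeta) * Cmod (xi + Cconj zeta)))%R.
Proof.
intros Hh Hpos Hxi Hzeta. pose proof (Hpos xi Hxi) as Hu. pose proof (Hpos zeta Hzeta) as Hv.
unfold right_half_plane in Hxi, Hzeta.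
destruct (Ceq_dec xi zeta) as [->|Hne].
{ rewrite !Cmod2_plus_conj. right. ring. }
set (N := (Cmod (xi + Cconj zeta) * Cmod (xi + Cconj zeta))%R).
assert (HN : (0 <= N)%R) by (apply Rmult_le_pos; apply Cmod_ge_0).
set (U := Re (h xi)) in *. set (V := Re (h zeta)) in *.
assert (Heps : forall eps : R, (0 < eps < 1)%R ->
  (Cmod (h xi + Cconj (h zeta)) * Cmod (h xi + Cconj (h zeta)) * (Re xi * Re zeta) <= U * V * N + eps * ((U + V + 1) * N))%R).
{ intros eps He.
  assert (HS := Schwarz_Pick_strict (fun z => h z + RtoC eps) xi zeta).
  assert (HS' : (Cmod (h xi + eps - (h zeta + eps)) * Cmod (xi + Cconj zeta) <=
     Cmod (h xi + eps + Cconj (h zeta + eps)) * Cmod (xi - zeta))%R).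
  { apply HS; try assumption.
    - intros w Hw. destruct (Hh w Hw) as [k Hk]. eexists. exact (cderiv_plus _ _ w _ _ Hk (cderiv_const (RtoC eps) w)).
    - intros w Hw. rewrite re_plus, re_RtoC. specialize (Hpos w Hw). lra. }
  clear HS.
  assert (HS2 : (Cmod (h xi + eps - (h zeta + eps)) * Cmod (h xi + eps - (h zeta + eps)) * N <=
     Cmod (h xi + eps + Cconj (h zeta + eps)) * Cmod (h xi + eps + Cconj (h zeta + eps)) * (Cmod (xi - zeta) * Cmod (xi - zeta)))%R).
  { unfold N.
    pose proof (Rmult_le_pos _ _ (Cmod_ge_0 (h xi + eps - (h zeta + eps))) (Cmod_ge_0 (xi + Cconj zeta))) as HP.
    pose proof (Rmult_le_compat _ _ _ _ HP HP HS' HS'). lra. }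
  rewrite Cmod2_plus_conj, !Cmod2_minus in HS2. rewrite !re_plus, !im_plus, re_RtoC, im_RtoC in HS2.
  rewrite Cmod2_plus_conj. fold U V. fold U V in HS2.
  assert (EN : N = ((Re xi + Re zeta) * (Re xi + Re zeta) + (Im xi - Im zeta) * (Im xi - Im zeta))%R) by apply Cmod2_plus_conj.
  set (s := ((Im (h xi) - Im (h zeta)) * (Im (h xi) - Im (h zeta)))%R).
  replace ((Im (h xi) + 0 - (Im (h zeta) + 0)) * (Im (h xi) + 0 - (Im (h zeta) + 0)))%R with s in HS2 by (unfold s; ring).
  replace ((Re xi - Re zeta) * (Re xi - Re zeta) + (Im xi - Im zeta) * (Im xi - Im zeta))%R with (N - 4 * (Re xi * Re zeta))%R in HS2
    by (rewrite EN; ring).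
  set (xz := (Re xi * Re zeta)%R) in *.
  assert (Hxz : (0 < xz)%R) by (apply Rmult_lt_0_compat; assumption).
  (* For both pairs of points, [|a - b| ^ 2 = |a + conj b| ^ 2 - 4 * Re a * Re b]. Inserted in the
     squared inequality, this cancels the common product and leaves the determinant form. *)
  assert (HK : (((U + eps + (V + eps)) * (U + eps + (V + eps)) + s) * xz <= (U + eps) * (V + eps) * N)%R) by nra.
  assert (HL : (((U + V) * (U + V) + s) * xz <= ((U + eps + (V + eps)) * (U + eps + (V + eps)) + s) * xz)%R).
  { apply Rmult_le_compat_r; [lra|]. nra. }
  assert (HR : ((U + eps) * (V + eps) * N <= (U * V + eps * (U + V + 1)) * N)%R).
  { apply Rmult_le_compat_r; [lra|]. nra. }
  lra. }
apply Rnot_lt_le. intros Hlt.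
set (X := (Cmod (h xi + Cconj (h zeta)) * Cmod (h xi + Cconj (h zeta)) * (Re xi * Re zeta))%R) in *.
set (Y := ((U + V + 1) * N)%R) in *.
assert (HY : (0 <= Y)%R) by (apply Rmult_le_pos; lra).
set (eps := Rmin (1 / 2) ((X - U * V * N) / (2 * (Y + 1)))).
assert (E1 : (eps <= 1 / 2)%R) by apply Rmin_l.
assert (E2 : (eps <= (X - U * V * N) / (2 * (Y + 1)))%R) by apply Rmin_r.
assert (E0 : (0 < eps)%R) by (unfold eps; apply Rmin_case; [lra|apply Rdiv_lt_0_compat; lra]).
apply Rle_div_r in E2; [|lra].
specialize (Heps eps ltac:(lra)). nra.
Qed.

(** * Rogers functions *)

Lemma neq_0_rhp z : (0 < Re z)%R -> z <> 0.
Proof. intros H ->. rewrite re_RtoC in H. lra. Qed.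

Lemma Re_mul_conj_nonneg (a b : C) : (0 <= Re (a * Cconj b))%R -> (0 <= Re (a / b))%R.
Proof.
(* For [b = 0] the quotient is [0], since both coordinates of [/ 0] have numerator [0]. *)
intros H. destruct (Ceq_dec b 0) as [->|Hb].
{ replace (a / 0) with (RtoC 0); [rewrite re_RtoC; lra|].
  unfold Cdiv, Cinv, Cmult, RtoC; simpl. unfold Rdiv. apply injective_projections; simpl; ring. }
replace (a / b) with (RtoC (/ (Cmod b ^ 2)) * (a * Cconj b)).
- rewrite re_scal_l. apply Rmult_le_pos; [|exact H].
  apply Rlt_le, Rinv_0_lt_compat, pow_lt, Cmod_gt_0, Hb.
- assert (Hb2 : Cconj b <> 0).
  { intros E. apply Hb. rewrite <- (Cconj_conj b), E. unfold Cconj, RtoC; simpl. f_equal; ring. }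
  rewrite RtoC_inv by (apply pow_nonzero, Rgt_not_eq, Cmod_gt_0, Hb).
  rewrite Cmod2_conj. field. split; assumption.
Qed.

Definition numerator (f : C -> C) (zeta xi : C) : C :=
  f xi - Re (f zeta) - (Ci * xi + Im zeta) / Re zeta * Im (f zeta).

Lemma numerator_at f zeta : (0 < Re zeta)%R -> numerator f zeta zeta = 0.
Proof.
intros H. unfold numerator.
replace (Ci * zeta + Im zeta) with (Ci * Re zeta).
- replace (f zeta) with (Re (f zeta) + Ci * Im (f zeta)) at 1.
  + field. intros E. apply RtoC_inj in E. lra.
  + unfold Ci, RtoC, Re, Im, Cplus, Cmult. apply injective_projections; simpl; ring.
- unfold Ci, RtoC, Re, Im, Cplus, Cmult. apply injective_projections; simpl; ring.
Qed.

(* [conj c * P * c], where [P] is the 2 x 2 Pick matrix of the values [u], [v] at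
   [xi], [zeta] and [c] is proportional to [(xi, - zeta)]; denominators are cleared. *)
Lemma numerator_Pick_form (u v xi zeta n : C) :
  n * Re zeta = (xi * u - Re (zeta * v)) * Re zeta - (Ci * xi + Im zeta) * Im (zeta * v) ->
  (Re zeta * Re (xi * n * Cconj ((xi - zeta) * (xi + Cconj zeta))) =
   Cmod xi ^ 2 * Re u * Re zeta * Cmod (xi + Cconj zeta) ^ 2 +
   Cmod zeta ^ 2 * Re v * Re xi * Cmod (xi + Cconj zeta) ^ 2 -
   2 * Re xi * Re zeta * Re (xi * Cconj zeta * (u + Cconj v) * Cconj (xi + Cconj zeta)))%R.
Proof.
intros Hn.
replace (Re zeta * Re (xi * n * Cconj ((xi - zeta) * (xi + Cconj zeta))))%R with
 (Re (xi * (n * Re zeta) * Cconj ((xi - zeta) * (xi + Cconj zeta)))).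
- rewrite Hn, !Cmod2_alt. clear. destruct u as [u1 u2], v as [v1 v2], xi as [x y], zeta as [a b].
  unfold Cconj, Ci, RtoC, Cplus, Cminus, Cmult, Copp, Re, Im. simpl. ring.
- rewrite <- re_scal_l. f_equal. ring.
Qed.

(** [n] stands for the numerator of [f = xi * h], given by an equation free of division. The Pick
    form is a sum of two nonnegative diagonal terms and a cross term, which Schwarz-Pick bounds by
    their geometric mean. *)
Lemma transform_Re_nonneg h xi zeta n : holomorphic_on right_half_plane h ->
  (forall z, right_half_plane z -> (0 <= Re (h z))%R) ->
  right_half_plane xi -> right_half_plane zeta ->
  n * Re zeta = (xi * h xi - Re (zeta * h zeta)) * Re zeta - (Ci * xi + Im zeta) * Im (zeta * h zeta) ->
  (0 <= Re (xi * n / ((xi - zeta) * (xi + Cconj zeta))))%R.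
Proof.
intros Hh Hpos Hxi Hzeta Hn.
apply Re_mul_conj_nonneg.
pose proof (Schwarz_Pick h xi zeta Hh Hpos Hxi Hzeta) as HP.
pose proof (numerator_Pick_form _ _ _ _ _ Hn) as HF.
pose proof (Hpos xi Hxi) as Hu. pose proof (Hpos zeta Hzeta) as Hv.
unfold right_half_plane in Hxi, Hzeta.
set (T := xi * Cconj zeta * (h xi + Cconj (h zeta)) * Cconj (xi + Cconj zeta)) in *.
assert (HT : (Re T * Re T <= Cmod xi ^ 2 * Cmod zeta ^ 2 * (Cmod (h xi + Cconj (h zeta)) * Cmod (h xi + Cconj (h zeta))) * Cmod (xi + Cconj zeta) ^ 2)%R).
{ apply Rle_trans with (Cmod T * Cmod T)%R.
  - rewrite Cmod2_coords. nra.
  - right. unfold T. rewrite !Cmod_mult, !Cmod_conj. ring. }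
set (N := (Cmod (xi + Cconj zeta) ^ 2)%R) in *.
replace (Cmod (xi + Cconj zeta) * Cmod (xi + Cconj zeta))%R with N in HP by (unfold N; ring).
set (W := (Cmod (h xi + Cconj (h zeta)) * Cmod (h xi + Cconj (h zeta)))%R) in *.
set (x2 := (Cmod xi ^ 2)%R) in *. set (z2 := (Cmod zeta ^ 2)%R) in *.
assert (Hx2 : (0 <= x2)%R) by (apply pow_le, Cmod_ge_0).
assert (Hz2 : (0 <= z2)%R) by (apply pow_le, Cmod_ge_0).
assert (HN : (0 <= N)%R) by (apply pow_le, Cmod_ge_0).
set (U := Re (h xi)) in *. set (V := Re (h zeta)) in *.
set (x := Re xi) in *. set (a := Re zeta) in *.
clearbody x2 z2 N U V W x a.
(* The diagonal terms of the form. The cross term is [2 * (x * a * Re T)], and its domination by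
   [al + be] is the inequality of arithmetic and geometric means. *)
set (al := (x2 * U * a * N)%R) in *. set (be := (z2 * V * x * N)%R) in *.
assert (Hal : (0 <= al)%R) by (unfold al; repeat apply Rmult_le_pos; lra).
assert (Hbe : (0 <= be)%R) by (unfold be; repeat apply Rmult_le_pos; lra).
assert (Hsq : ((x * a * Re T) * (x * a * Re T) <= al * be)%R).
{ apply Rle_trans with ((x * a) * (x * a) * (x2 * z2 * W * N))%R.
  - replace ((x * a * Re T) * (x * a * Re T))%R with ((x * a) * (x * a) * (Re T * Re T))%R by ring.
    apply Rmult_le_compat_l; [|exact HT]. repeat apply Rmult_le_pos; lra.
  - replace (al * be)%R with (x * a * (x2 * z2 * N) * (U * V * N))%R by (unfold al, be; ring).
    replace ((x * a) * (x * a) * (x2 * z2 * W * N))%R with (x * a * (x2 * z2 * N) * (W * (x * a)))%R by ring.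
    apply Rmult_le_compat_l; [repeat apply Rmult_le_pos; lra|exact HP]. }
assert (HAM : (2 * (x * a * Re T) <= al + be)%R).
{ apply Rnot_lt_le. intros Hlt.
  assert ((al + be) * (al + be) < 2 * (x * a * Re T) * (2 * (x * a * Re T)))%R by (apply Rmult_le_0_lt_compat; lra).
  pose proof (Rle_0_sqr (al - be)) as Hs. unfold Rsqr in Hs. lra. }
assert (0 <= a * Re (xi * n * Cconj ((xi - zeta) * (xi + Cconj zeta))))%R by lra.
apply Rmult_le_reg_l with a; [exact Hzeta|]. lra.
Qed.

Lemma Re_nonneg_extend g zeta : right_half_plane zeta -> cont_at g zeta ->
  (forall xi, right_half_plane xi -> xi <> zeta -> (0 <= Re (g xi))%R) -> (0 <= Re (g zeta))%R.
Proof.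
intros Hz Hc Hpos. apply Rnot_lt_le. intros Hlt.
destruct (proj1 (continuous_C_iff g zeta) Hc (- Re (g zeta))%R ltac:(lra)) as [d [Hd H]].
set (y := zeta + RtoC (d / 2)).
assert (Hy : y - zeta = RtoC (d / 2)) by (unfold y; ring).
assert (Hyz : y <> zeta).
{ intros E. rewrite E in Hy. replace (zeta - zeta) with (RtoC 0) in Hy by ring. apply RtoC_inj in Hy. lra. }
specialize (H y). rewrite Hy, Cmod_R, Rabs_pos_eq in H by lra. specialize (H ltac:(lra)).
assert (Hyr : right_half_plane y) by (unfold right_half_plane, y in *; rewrite re_plus, re_RtoC; lra).
specialize (Hpos y Hyr Hyz).
pose proof (re_le_Cmod (g y - g zeta)) as Hre. change (Re (g y - g zeta)) with (Re (g y) - Re (g zeta))%R in Hre.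
apply Rabs_le_between in Hre. lra.
Qed.

Lemma RtoC_Re_of_real z : Im z = 0%R -> RtoC (Re z) = z.
Proof. intros H. unfold RtoC. rewrite <- H. destruct z; reflexivity. Qed.

Theorem lemma7p1 : forall (f : C -> C) (zeta : C),
  Rogers f -> right_half_plane zeta ->
  (exists G : C -> C,
     continuous_extension (rogers_g f zeta) zeta G /\ Rogers G) /\
  (nonconstant_rhp f ->
   Im (f zeta) = 0%R -> (0 < Re (f zeta))%R ->
   (* the formula and the value at [zeta] involve no division by zero *)
   (forall xi : C, right_half_plane xi -> xi <> zeta -> f xi <> f zeta) /\
   C_derive f zeta <> 0 /\
   exists F : C -> C,
     continuous_extension (rogers_bracket f zeta) zeta F /\
     F zeta = 2 * Re zeta / C_derive f zeta /\
     Rogers F).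
Proof.
intros f zeta [Hf Hfpos] Hzeta. unfold right_half_plane in Hzeta.
assert (Hz0 : RtoC (Re zeta) <> 0) by (intros E; apply RtoC_inj in E; lra).
destruct (Hf zeta Hzeta) as [l Hl]. change (cderiv f zeta l) in Hl.
set (h := fun xi => f xi * / xi).
assert (Hh : holomorphic_on right_half_plane h).
{ intros w Hw. destruct (Hf w Hw) as [m Hm]. eexists.
  exact (cderiv_mult f Cinv w _ _ Hm (cderiv_inv w (neq_0_rhp w Hw))). }
set (k := numerator f zeta).
(* Slope in [xi] of the affine function subtracted from [f]. *)
set (s := Ci / Re zeta * Im (f zeta)).
assert (Hkd : forall w m, cderiv f w m -> cderiv k w (m - s)).
{ intros w m Hm.
  apply (is_derive_ext (K := C_AbsRing) (V := C_NormedModule)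
    (fun w => f w - (s * w + (Re (f zeta) + Im zeta / Re zeta * Im (f zeta))))).
  - intros t. Ceq. unfold k, numerator, s. field. exact Hz0.
  - apply cderiv_minus; [exact Hm|].
    pose proof (cderiv_plus _ _ w _ _ (cderiv_scal s _ w _ (cderiv_id w))
      (cderiv_const (Re (f zeta) + Im zeta / Re zeta * Im (f zeta)) w)) as H.
    rewrite Cmult_1_r, Cplus_0_r in H. exact H. }
assert (Hk : holomorphic_on right_half_plane k).
{ intros w Hw. destruct (Hf w Hw) as [m Hm]. exists (m - s). apply Hkd, Hm. }
assert (Hk0 : k zeta = 0) by (apply numerator_at; exact Hzeta).
set (K := diff_quot k zeta (l - s)).
assert (HK : holomorphic_on right_half_plane K).
{ apply diff_quot_holomorphic; auto using Goursat_domain_rhp. }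
assert (HKk : forall w, (w - zeta) * K w = k w).
{ intros w. unfold K. rewrite diff_quot_mult, Hk0. ring. }
assert (Hxz : forall xi, right_half_plane xi -> xi + Cconj zeta <> 0).
{ intros xi Hxi. apply plus_conj_neq_0; assumption. }
(* This is the function of the theorem divided by [xi], already continued through [zeta] by means of
   [K], the continuation of [k xi / (xi - zeta)]. The extension itself is [G] below. *)
set (g := fun xi => xi * (/ (xi + Cconj zeta) * K xi)).
assert (Hden : forall w, exists m, cderiv (fun xi => xi + Cconj zeta) w m).
{ intros w. eexists. exact (cderiv_plus _ _ w _ _ (cderiv_id w) (cderiv_const (Cconj zeta) w)). }
assert (Hg : holomorphic_on right_half_plane g).
{ intros w Hw. destruct (HK w Hw) as [m Hm]. destruct (Hden w) as [m1 Hm1].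
  pose proof (cderiv_comp Cinv _ w _ _ (cderiv_inv _ (Hxz w Hw)) Hm1) as H2.
  eexists. exact (cderiv_mult _ _ w _ _ (cderiv_id w) (cderiv_mult _ _ w _ _ H2 Hm)). }
set (G := fun xi => xi * g xi).
assert (HG : holomorphic_on right_half_plane G).
{ intros w Hw. destruct (Hg w Hw) as [m Hm]. eexists. exact (cderiv_mult _ _ w _ _ (cderiv_id w) Hm). }
assert (Hgpos : forall xi, right_half_plane xi -> (0 <= Re (g xi))%R).
{ assert (Hoff : forall xi, right_half_plane xi -> xi <> zeta -> (0 <= Re (g xi))%R).
  { intros xi Hxi Hne.
    replace (g xi) with (xi * k xi / ((xi - zeta) * (xi + Cconj zeta))).
    - apply (transform_Re_nonneg h); try assumption.
      unfold h, k, numerator.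
      replace (xi * (f xi * / xi)) with (f xi) by (field; apply neq_0_rhp, Hxi).
      replace (zeta * (f zeta * / zeta)) with (f zeta) by (field; apply neq_0_rhp, Hzeta).
      field. exact Hz0.
    - rewrite <- HKk. unfold g. field. split; [apply Hxz, Hxi|apply Cminus_eq_contra, Hne]. }
  intros xi Hxi. destruct (Ceq_dec xi zeta) as [->|Hne]; [|apply Hoff; assumption].
  destruct (Hg zeta Hzeta) as [m Hm]. exact (Re_nonneg_extend g zeta Hzeta (cderiv_continuous _ _ _ Hm) Hoff). }
split.
{ exists G. split; [split|split].
  - intros xi Hxi Hne. unfold rogers_g. fold (numerator f zeta xi). fold k. rewrite <- HKk.
    unfold G, g. field. split; [apply Hxz, Hxi|apply Cminus_eq_contra, Hne].
  - destruct (HG zeta Hzeta) as [m Hm]. exact (cderiv_continuous _ _ _ Hm).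
  - exact HG.
  - intros xi Hxi. replace (G xi / xi) with (g xi); [apply Hgpos, Hxi|].
    unfold G. field. apply neq_0_rhp, Hxi. }
intros Hnc Him Hre.
assert (Hs : s = 0) by (unfold s; rewrite Him; ring).
assert (Hkf : forall w, k w = f w - f zeta).
{ intros w. unfold k, numerator. rewrite Him, (RtoC_Re_of_real _ Him). ring. }
(* If [g w = 0], Schwarz-Pick at [xi] and [w] reads [Cmod (g xi) ^ 2 * (Re xi * Re w) <= 0]. The
   point [w = zeta] is included; there it says that the derivative of [f] at [zeta] is nonzero. *)
assert (HK0 : forall w, right_half_plane w -> K w <> 0).
{ intros w Hw E. apply Hnc. exists (f zeta). intros xi Hxi.
  assert (Hgw : g w = 0) by (unfold g; rewrite E; ring).
  pose proof (Schwarz_Pick g xi w Hg Hgpos Hxi Hw) as HP.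
  rewrite Hgw in HP. replace (g xi + Cconj 0) with (g xi) in HP
    by (unfold Cconj, RtoC, Cplus; apply injective_projections; simpl; ring).
  rewrite (re_RtoC 0), Rmult_0_r, Rmult_0_l in HP.
  assert (Hgx : g xi = 0).
  { apply Cmod_eq_0. pose proof (Cmod_ge_0 (g xi)) as H0.
    assert (0 < Re xi * Re w)%R by (apply Rmult_lt_0_compat; assumption).
    destruct (Rle_lt_or_eq_dec _ _ H0) as [H1|H1]; [|symmetry; exact H1].
    assert (0 < Cmod (g xi) * Cmod (g xi) * (Re xi * Re w))%R by (apply Rmult_lt_0_compat; [apply Rmult_lt_0_compat|]; assumption). lra. }
  assert (HKx : K xi = 0).
  { replace (K xi) with (g xi * ((xi + Cconj zeta) / xi)).
    - rewrite Hgx. ring.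
    - unfold g. field. split; [apply neq_0_rhp, Hxi|apply Hxz, Hxi]. }
  apply Ceq_minus. rewrite <- Hkf, <- HKk, HKx. ring. }
assert (HKz : K zeta = C_derive f zeta).
{ unfold K. rewrite diff_quot_at, Hs. rewrite (is_C_derive_unique f zeta l Hl). ring. }
assert (Hne_f : forall xi : C, right_half_plane xi -> xi <> zeta -> f xi <> f zeta).
{ intros xi Hxi Hne E. apply (Cmult_neq_0 (xi - zeta) (K xi)).
  - apply Cminus_eq_contra, Hne.
  - apply HK0, Hxi.
  - rewrite HKk, Hkf, E. ring. }
split; [exact Hne_f|]. split; [rewrite <- HKz; apply HK0, Hzeta|].
(* Since [f xi - f zeta = (xi - zeta) * K xi], the factor [xi - zeta] cancels from the bracket.
   Moreover [F xi / xi = 1 / g xi], and taking reciprocals preserves a nonnegative real part. *)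
set (F := fun xi => (xi + Cconj zeta) * / K xi).
assert (HF : holomorphic_on right_half_plane F).
{ intros w Hw. destruct (HK w Hw) as [m Hm]. destruct (Hden w) as [m1 Hm1].
  pose proof (cderiv_comp Cinv _ w _ _ (cderiv_inv _ (HK0 w Hw)) Hm) as H2.
  eexists. exact (cderiv_mult _ _ w _ _ Hm1 H2). }
exists F. split; [split|split; [|split]].
- intros xi Hxi Hne. unfold rogers_bracket. rewrite <- Hkf, <- HKk. unfold F. field.
  split; [apply HK0, Hxi|apply Cminus_eq_contra, Hne].
- destruct (HF zeta Hzeta) as [m Hm]. exact (cderiv_continuous _ _ _ Hm).
- unfold F. rewrite HKz. replace (zeta + Cconj zeta) with (2 * Re zeta); [reflexivity|].
  rewrite re_alt. field.
- exact HF.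
- intros xi Hxi. replace (F xi / xi) with (1 / g xi).
  + apply Re_mul_conj_nonneg. rewrite Cmult_1_l, re_conj. apply Hgpos, Hxi.
  + unfold F, g. field. repeat split; auto. exact (neq_0_rhp xi Hxi).
Qed.
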